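(* Let $A$ be an artinian local ring. There exists a unique Steinberg map $\nu\colon A((t))^\times\times A((t))^\times\to A^\times$ which belongs to the cohomology class $$[\{\cdot,\cdot\}_{A((t))}^{A[[t]]}]\in H^2(A((t))^\times,A^\times)$$ and satisfies, for all $f,g\in A((t))^\times$, $$\nu(f,g)=\{f,g\}_{A((t))}^{A[[t]]}\quad\text{if } w(f)=0.$$ This unique map $\nu$ is the Contou-Carrère symbol $\langle\cdot,\cdot\rangle_{A((t))^\times}$.
   Context: Rings are commutative with unit, and $R^\times$ denotes the group of units of a ring $R$. $A((t))$ is the ring of series $\sum_{i\in\mathbb{Z}} a_i t^i$ with $a_i\in A$ and $a_i=0$ for $i\ll 0$; $A[[t]]\subset A((t))$ is the subring of power series. Let $m$ be the maximal ideal of the artinian local ring $A$. Every $f\in A((t))^\times$ can be written in exactly one way as $$f = a_0\cdot t^{w(f)}\cdot \prod_{i=1}^{\infty}(1-a_i t^i)\cdot\prod_{i=1}^{\infty}(1-a_{-i}t^{-i}),$$ with $w(f)\in\mathbb{Z}$ (the winding number of $f$), $a_0\in A^\times$, $a_i\in A$ and $a_{-i}\in m$ for $i>0$, and $a_{-i}=0$ for $i\gg 0$. Let $g\in A((t))^\times$ be written in the same way with coefficients $b_i$ and winding number $w(g)$. The map $\{\cdot,\cdot\}_{A((t))}^{A[[t]]}\colon A((t))^\times\times A((t))^\times\to A^\times$ is the commutator pairing $\{f,g\}=\tilde f\tilde g\tilde f^{-1}\tilde g^{-1}$ (with $\tilde f,\tilde g$ arbitrary lifts of $f,g$) of a certain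 central extension $1\to A^\times\to \widetilde{A((t))^\times}\to A((t))^\times\to 1$, and its value is given explicitly by $$\{f,g\}_{A((t))}^{A[[t]]} = \frac{a_0^{w(g)}\prod_{i=1}^{\infty}\prod_{j=1}^{\infty}\bigl(1-a_i^{j/(i,j)}b_{-j}^{i/(i,j)}\bigr)^{(i,j)}}{b_0^{w(f)}\prod_{i=1}^{\infty}\prod_{j=1}^{\infty}\bigl(1-a_{-i}^{j/(i,j)}b_{j}^{i/(i,j)}\bigr)^{(i,j)}}\in A^\times,$$ where $(i,j)$ denotes the greatest common divisor; only finitely many factors in the infinite products differ from $1$. The Contou-Carrère symbol is $$\langle f,g\rangle_{A((t))^\times}=(-1)^{w(f)w(g)}\cdot\{f,g\}_{A((t))}^{A[[t]]}.$$ A map $\psi\colon A((t))^\times\times A((t))^\times\to A^\times$ is called a Steinberg map when $\psi$ is bimultiplicative and $\psi(f,1-f)=1$ for all $f\in A((t))^\times$ such that $1-f\in A((t))^\times$. For commutative groups $G$ and $B$ (with $G$ acting trivially on $B$), $H^2(G,B)$ is the group of 2-cocycles $c\colon G\times G\to B$ modulo 2-coboundaries, where a 2-cocycle $b$ is a 2-coboundary when there is a map $\phi\colon G\to B$ with $b(\alpha,\beta)=\phi(\alpha\cdot\beta)\cdot\phi(\alpha)^{-1}\cdot\phi(\beta)^{-1}$ for all $\alpha,\beta\in G$. The map $\{\cdot,\cdot\}_{A((t))}^{A[[t]]}$ is bimultiplicative, hence a 2-cocycle, and determines a class in $H^2(A((t))^\times,A^\times)$. A map ''belongs to'' a cohomology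 class if it is a 2-cocycle representing that class. *)

(* Defs.v *)
From HB Require Import structures.
From mathcomp Require Import all_boot all_order all_algebra.
From mathcomp Require Import zify.
From mathcomp Require Import boolp classical_sets functions fsbigop.

Set Implicit Arguments.
Unset Strict Implicit.
Unset Printing Implicit Defensive.

Import Order.TTheory GRing.Theory Num.Theory.

Local Open Scope classical_set_scope.
Local Open Scope ring_scope.

Section Ideals.
Variable A : comUnitRingType.

Definition is_ideal (I : set A) : Prop :=
  [/\ I 0, forall x y, I x -> I y -> I (x + y) & forall a x, I x -> I (a * x)].

Definition maximal_ideal (m : set A) : Prop :=
  [/\ is_ideal m, m <> setT &
      forall J, is_ideal J -> m `<=` J -> J <> setT -> J = m].

Definition local_ring : Prop := exists! m, maximal_ideal m.

Definition artinian_ring : Prop :=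
  forall I : nat -> set A, (forall n, is_ideal (I n)) ->
    (forall n, I n.+1 `<=` I n) ->
    exists n, forall k, (n <= k)%N -> I k = I n.

(* Only meaningful when [A] is local. *)
Definition the_maximal_ideal : set A := xget setT maximal_ideal.

Lemma the_maximal_idealP : local_ring -> maximal_ideal the_maximal_ideal.
Proof. by move=> [m [mm _]]; apply: (xgetI _ mm). Qed.

Lemma ideal_neqT (I : set A) : is_ideal I -> I <> setT -> ~ I 1.
Proof.
move=> [_ _ IM] IT I1; apply: IT; apply/seteqP; split => // x _.
by rewrite -(mulr1 x); exact: IM.
Qed.

Lemma nonunit_maximal (x : A) :
  x \isn't a GRing.unit -> exists2 m, maximal_ideal m & m x.
Proof.
move=> xNU.
pose P (J : set A) := J = set0 \/ [/\ is_ideal J, ~ J 1 & J x].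
have Punion (F : set (set A)) : F `<=` P -> total_on F subset ->
    P (\bigcup_(X in F) X).
  move=> FP Ftot.
  have [[J FJ J0]|F0] := pselect (exists2 J, F J & J !=set0); last first.
    left; apply/seteqP; split => // y [J FJ Jy].
    by case: F0; exists J => //; exists y.
  have Fid K y : F K -> K y -> [/\ is_ideal K, ~ K 1 & K x].
    by move=> FK Ky; case: (FP _ FK) => // K0; rewrite K0 in Ky.
  have {J0} [Jid _ Jx] : [/\ is_ideal J, ~ J 1 & J x].
    by case: J0 => y Jy; exact: (Fid J y).
  right; split; last by exists J.
  - split; first by exists J => //; case: Jid.
    + move=> y z [K FK Ky] [L FL Lz].
      have [[_ KD _] _ _] := Fid _ _ FK Ky.
      have [[_ LD _] _ _] := Fid _ _ FL Lz.
      case: (Ftot K L FK FL) => sub.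
        by exists L => //; apply: LD => //; exact: sub.
      by exists K => //; apply: KD => //; exact: sub.
    + move=> a y [K FK Ky]; have [[_ _ KM] _ _] := Fid _ _ FK Ky.
      by exists K => //; exact: KM.
  - by move=> [K FK K1]; have [_ +] := Fid _ _ FK K1.
have [m [Pm mmax]] := Zorn_bigcup Punion.
pose I : set A := [set y | exists a, y = a * x].
have PI : P I.
  right; split; last by exists 1; rewrite mul1r.
  - split; first by exists 0; rewrite mul0r.
    + by move=> _ _ [a ->] [b ->]; exists (a + b); rewrite mulrDl.
    + by move=> a _ [b ->]; exists (a * b); rewrite mulrA.
  - move=> [a a1]; move/negP: xNU; apply.
    by apply/unitrPr; exists a; rewrite mulrC -a1.
have [m0|[mid m1 mx]] := Pm.
  exfalso; apply: (mmax I) => //; rewrite m0; split => // I0.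
  by apply: (I0 x); exists 1; rewrite mul1r.
exists m => //; split => //.
  by move=> mT; apply: m1; rewrite mT.
move=> J Jid mJ JT; apply: contrapT => JNm; apply: (mmax J).
  by split=> // Jm; apply: JNm; apply/seteqP.
by right; split => //; [exact: ideal_neqT | exact: mJ].
Qed.

Lemma maximal_ideal_unitB (x : A) : local_ring ->
  the_maximal_ideal x -> 1 - x \is a GRing.unit.
Proof.
move=> Aloc mx; have mm := the_maximal_idealP Aloc.
have [mid mT _] := mm; have m1 := ideal_neqT mid mT.
apply: contrapT => /negP /nonunit_maximal [m' m'm m'x].
have [m0 [_ uniq_m]] := Aloc.
apply: m1; rewrite -(subrK x 1); case: mid => _ + _; apply => //.
by rewrite -(uniq_m _ mm) (uniq_m _ m'm).
Qed.

End Ideals.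

Section Units.
Variable R : comUnitRingType.

Record units := Units { uval :> R; uvalP : uval \is a GRing.unit }.

HB.instance Definition _ := [isSub for uval].
HB.instance Definition _ := [Choice of units by <:].


Definition units_one : units := Units (unitr1 R).
Definition units_inv (x : units) : units :=
  Units (etrans (unitrV (uval x)) (uvalP x)).

Lemma units_mul_subproof (x y : units) : uval x * uval y \is a GRing.unit.
Proof. by rewrite unitrM !uvalP. Qed.
Definition units_mul (x y : units) : units := Units (units_mul_subproof x y).

Fact units_mulA : associative units_mul.
Proof. by move=> x y z; apply: val_inj; rewrite /= mulrA. Qed.
Fact units_mul1 : left_id units_one units_mul.
Proof. by move=> x; apply: val_inj; rewrite /= mul1r. Qed.
Fact units_1mul : right_id units_one units_mul.
Proof. by move=> x; apply: val_inj; rewrite /= mulr1. Qed.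
Fact units_mulV : left_inverse units_one units_inv units_mul.
Proof. by move=> x; apply: val_inj; rewrite /= mulVr ?uvalP. Qed.
Fact units_Vmul : right_inverse units_one units_inv units_mul.
Proof. by move=> x; apply: val_inj; rewrite /= divrr ?uvalP. Qed.

HB.instance Definition _ :=
  isGroup.Build units units_mulA units_mul1 units_1mul units_mulV units_Vmul.

Lemma units_mulC (x y : units) : (x * y = y * x)%g.
Proof. by apply: val_inj; rewrite /= mulrC. Qed.

End Units.

(* These notions are used for commutative [G] and [B], with trivial action. *)
Section Cohomology.
Variables G B : groupType.
Local Open Scope group_scope.

Definition cocycle2 (c : G -> G -> B) : Prop :=
  forall x y z, c x y * c (x * y) z = c y z * c x (y * z).

Definition coboundary2 (b : G -> G -> B) : Prop :=
  exists phi : G -> B, forall x y, b x y = phi (x * y) * (phi x)^-1 * (phi y)^-1.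

(* The class of [c] in [H^2(G, B)], as a coset of the 2-coboundaries among the
   2-cocycles. *)
Definition cohomology_class (c : G -> G -> B) : set (G -> G -> B) :=
  [set c' | cocycle2 c' /\ coboundary2 (fun x y => c' x y * (c x y)^-1)].

Definition bimultiplicative (psi : G -> G -> B) : Prop :=
  (forall x y z, psi (x * y) z = psi x z * psi y z) /\
  (forall x y z, psi x (y * z) = psi x y * psi x z).

End Cohomology.

Section Laurent.
Variable A : comUnitRingType.

Record laurent := Laurent {
  lcoef :> int -> A;
  lcoef_bounded : exists a : int, forall n, n < a -> lcoef n = 0
}.

HB.instance Definition _ := gen_eqMixin laurent.
HB.instance Definition _ := gen_choiceMixin laurent.

Lemma laurentP (f g : laurent) : lcoef f =1 lcoef g -> f = g.
Proof.
case: f g => [f fP] [g gP] /= fg; have {}fg : f = g by apply: funext.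
by subst g; congr Laurent; exact: Prop_irrelevance.
Qed.

#[local] Obligation Tactic := idtac.

(* [lmonom c d] is the monomial [c t^d]. *)
Program Definition lmonom (c : A) (d : int) : laurent :=
  Laurent (lcoef := fun n => if n == d then c else 0) _.
Next Obligation. by move=> c d; exists d => n; rewrite lt_neqAle => /andP[/negPf->]. Qed.

Program Definition ladd (f g : laurent) : laurent :=
  Laurent (lcoef := fun n => f n + g n) _.
Next Obligation.
move=> f g; have [a fa] := lcoef_bounded f; have [b gb] := lcoef_bounded g.
by exists (Num.min a b) => n; rewrite lt_min => /andP[/fa -> /gb ->]; rewrite addr0.
Qed.

Program Definition lopp (f : laurent) : laurent :=
  Laurent (lcoef := fun n => - f n) _.
Next Obligation.
by move=> f; have [a fa] := lcoef_bounded f; exists a => n /fa ->; rewrite oppr0.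
Qed.

Definition lmul_coef (f g : int -> A) (n : int) : A :=
  \sum_(i \in [set: int]) f i * g (n - i).

Lemma lmul_coefE (f g : int -> A) (a b : int) :
    (forall n, n < a -> f n = 0) -> (forall n, n < b -> g n = 0) ->
  forall n (M : nat), n < a + b + M%:Z ->
  lmul_coef f g n = \sum_(k < M) f (a + k%:Z) * g (n - (a + k%:Z)).
Proof.
move=> fa gb n M nM; rewrite /lmul_coef.
rewrite (@fsbigE _ _ _ _ _ [seq a + k%:Z | k <- iota 0 M]) //=.
- rewrite big_map -[M in iota _ M]subn0 -/(index_iota 0 M) big_mkord.
  by apply: eq_bigl => k; rewrite in_setT.
- by rewrite map_inj_uniq ?iota_uniq // => x y /addrI [].
move=> i _ iNr; have [ia|ai] := ltP i a; first by rewrite fa ?mul0r.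
rewrite gb ?mulr0 //; rewrite ltNge; apply/negP => le_b.
move/negP: iNr; apply; apply/mapP; exists (absz (i - a)).
  by rewrite mem_iota; lia.
by lia.
Qed.

Program Definition lmul (f g : laurent) : laurent :=
  Laurent (lcoef := lmul_coef f g) _.
Next Obligation.
move=> f g; have [a fa] := lcoef_bounded f; have [b gb] := lcoef_bounded g.
exists (a + b) => n ltn.
by rewrite (lmul_coefE fa gb (M := 0)) ?big_ord0 ?addr0.
Qed.

Let trunc (a : int) (M : nat) (f : int -> A) : {poly A} :=
  \poly_(k < M) f (a + k%:Z).

Lemma lmul_trunc (f g : int -> A) (a b : int) (M k : nat) :
    (forall n, n < a -> f n = 0) -> (forall n, n < b -> g n = 0) -> (k < M)%N ->
  lmul_coef f g (a + b + k%:Z) = (trunc a M f * trunc b M g)`_k.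
Proof.
move=> fa gb kM; rewrite (lmul_coefE fa gb (M := k.+1)); last by lia.
rewrite coefM; apply: eq_bigr => -[j /= jk] _; rewrite !coef_poly.
rewrite !ifT; [|lia|lia]; congr (_ * g _); lia.
Qed.

Lemma lmul_bound (f g : int -> A) (a b : int) :
    (forall n, n < a -> f n = 0) -> (forall n, n < b -> g n = 0) ->
  forall n, n < a + b -> lmul_coef f g n = 0.
Proof.
by move=> fa gb n ltn; rewrite (lmul_coefE fa gb (M := 0)) ?big_ord0 ?addr0.
Qed.

Fact lmulC : commutative lmul.
Proof.
move=> f g; apply: laurentP => n /=.
have [a fa] := lcoef_bounded f; have [b gb] := lcoef_bounded g.
have [ltn|len] := ltP n (a + b).
  by rewrite (lmul_bound fa gb) ?(lmul_bound gb fa) // addrC.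
have [k ->] : exists k : nat, n = a + b + k%:Z by exists (absz (n - (a + b)%R)); lia.
rewrite (lmul_trunc fa gb (ltnSn k)) [a + b]addrC.
by rewrite (lmul_trunc gb fa (ltnSn k)) mulrC.
Qed.

Fact lmulA : associative lmul.
Proof.
move=> f g h; apply: laurentP => n /=.
have [a fa] := lcoef_bounded f; have [b gb] := lcoef_bounded g.
have [c hc] := lcoef_bounded h.
have fgab := lmul_bound fa gb; have ghbc := lmul_bound gb hc.
have [ltn|len] := ltP n (a + b + c).
  by rewrite (lmul_bound fa ghbc) ?(lmul_bound fgab hc) // addrA.
have [k ->] : exists k : nat, n = a + b + c + k%:Z.
  by exists (absz (n - (a + b + c)%R)); lia.
rewrite (lmul_trunc fgab hc (ltnSn k)) -(addrA a b c).
rewrite (lmul_trunc fa ghbc (ltnSn k)).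
transitivity ((trunc a k.+1 f * trunc b k.+1 g * trunc c k.+1 h)`_k).
  rewrite -mulrA !coefM; apply: eq_bigr => -[j /= jk] _; congr (_ * _).
  rewrite coef_poly ifT; last by lia.
  by rewrite (lmul_trunc gb hc (M := k.+1)) //; lia.
rewrite !coefM; apply: eq_bigr => -[j /= jk] _; congr (_ * _).
rewrite [RHS]coef_poly ifT; last by lia.
by rewrite (lmul_trunc fa gb (M := k.+1)) //; lia.
Qed.

Fact lmul1 : left_id (lmonom 1 0) lmul.
Proof.
move=> f; apply: laurentP => n /=; rewrite /lmul_coef.
rewrite (@fsbigE _ _ _ _ _ [:: 0]) //=; last first.
  by move=> i _; rewrite inE => /negPf ->; rewrite mul0r.
by rewrite big_cons big_nil in_setT eqxx mul1r subr0 addr0.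
Qed.

Fact lmulDl : left_distributive lmul ladd.
Proof.
move=> f g h; apply: laurentP => n /=.
have [a fa] := lcoef_bounded f; have [b gb] := lcoef_bounded g.
have [c hc] := lcoef_bounded h; pose d := Num.min a b.
have fd : forall n, n < d -> f n = 0 by move=> i; rewrite lt_min => /andP[/fa].
have gd : forall n, n < d -> g n = 0 by move=> i; rewrite lt_min => /andP[_ /gb].
have fgd : forall n, n < d -> ladd f g n = 0.
  by move=> i id /=; rewrite fd ?gd ?addr0.
have ltn : n < d + c + (absz (n - (d + c))%R).+1%:Z by lia.
rewrite (lmul_coefE fgd hc ltn) (lmul_coefE fd hc ltn) (lmul_coefE gd hc ltn).
by rewrite -big_split; apply: eq_bigr => k _; rewrite /= mulrDl.
Qed.

Fact laddA : associative ladd.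
Proof. by move=> f g h; apply: laurentP => n /=; rewrite addrA. Qed.
Fact laddC : commutative ladd.
Proof. by move=> f g; apply: laurentP => n /=; rewrite addrC. Qed.
Fact ladd0 : left_id (lmonom 0 0) ladd.
Proof. by move=> f; apply: laurentP => n /=; rewrite if_same add0r. Qed.
Fact laddN : left_inverse (lmonom 0 0) lopp ladd.
Proof. by move=> f; apply: laurentP => n /=; rewrite if_same addNr. Qed.

HB.instance Definition _ := GRing.isZmodule.Build laurent laddA laddC ladd0 laddN.

Fact lone_neq0 : lmonom 1 0 != 0 :> laurent.
Proof.
by apply/eqP => /(congr1 (fun f : laurent => f 0)) /eqP; rewrite /= oner_eq0.
Qed.

HB.instance Definition _ :=
  GRing.Zmodule_isComNzRing.Build laurent lmulA lmulC lmul1 lmulDl lone_neq0.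

Definition lunit : {pred laurent} := fun f => `[< exists g, g * f = 1 >].
Definition linv (f : laurent) : laurent := xget f [set g | g * f = 1].

Fact lmulV : {in lunit, left_inverse 1 linv *%R}.
Proof.
move=> f; rewrite unfold_in => /asboolP [g gf].
exact: (@xgetI _ f [set g | g * f = 1] g).
Qed.
Fact lunitP (f g : laurent) : g * f = 1 -> lunit f.
Proof. by move=> gf; apply/asboolP; exists g. Qed.
Fact linv_out : {in [predC lunit], linv =1 id}.
Proof.
move=> f; rewrite inE unfold_in => /asboolPn nf.
by apply: xgetPN => g gf; apply: nf; exists g.
Qed.

HB.instance Definition _ :=
  GRing.ComNzRing_hasMulInverse.Build laurent lmulV lunitP linv_out.

Lemma lcoefD (f g : laurent) (n : int) : (f + g) n = f n + g n.
Proof. by []. Qed.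

Lemma lcoefN (f : laurent) (n : int) : (- f) n = - f n.
Proof. by []. Qed.

Lemma lcoefM (f g : laurent) (n : int) :
  (f * g) n = \sum_(i \in [set: int]) f i * g (n - i).
Proof. by []. Qed.

Lemma lmonom_exp (d : nat) : lmonom 1 d = lmonom 1 1 ^+ d.
Proof.
elim: d => [|d IHd] //; rewrite exprS -IHd; apply: laurentP => n.
rewrite lcoefM (@fsbigE _ _ _ _ _ [:: 1]) //=; last first.
  by move=> i _; rewrite inE => /negPf ->; rewrite mul0r.
rewrite big_cons big_nil in_setT eqxx mul1r addr0.
by congr (if _ then _ else _); lia.
Qed.

Definition tadic_limit (u : nat -> laurent) (p : laurent) : Prop :=
  forall d : int, exists K : nat, forall k, (K <= k)%N ->
    forall n : int, n < d -> u k n = p n.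

(* [wfactor f w a] is
     [f = a_0 t^w \prod_(i >= 1) (1 - a_i t^i) \prod_(i >= 1) (1 - a_{-i} t^{-i})]
   with [a] indexed by the integers; the first infinite product, [p], is a
   t-adic limit, and the second one is finite. *)
Definition wfactor (f : laurent) (w : int) (a : int -> A) : Prop :=
  [/\ a 0 \is a GRing.unit,
      forall i : nat, (0 < i)%N -> the_maximal_ideal (a (- i%:Z)) &
      exists p N,
        [/\ tadic_limit (fun k => \prod_(1 <= i < k.+1) (1 - lmonom (a i) i)) p,
            forall i : nat, (N < i)%N -> a (- i%:Z) = 0 &
            f = lmonom (a 0) w * p *
                \prod_(1 <= i < N.+1) (1 - lmonom (a (- i%:Z)) (- i%:Z))]].

(* When [A] is artinian local, [wfactor f] holds for exactly one pair; the
   default value of [xget] is then never used. *)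
Definition wfactorization (f : units laurent) : int * (int -> A) :=
  xget (0, fun n => (n == 0)%:R) [set wa | wfactor (uval f) wa.1 wa.2].

Definition winding (f : units laurent) : int := (wfactorization f).1.
Definition wcoef (f : units laurent) : int -> A := (wfactorization f).2.


(* Only finitely many factors differ from 1 in the products used below. *)
Definition cc_prod (x y : nat -> A) : A :=
  \big[*%R/1]_(i \in [set i | (0 < i)%N]) \big[*%R/1]_(j \in [set j | (0 < j)%N])
    (1 - x i ^+ (j %/ gcdn i j) * y j ^+ (i %/ gcdn i j)) ^+ gcdn i j.

(* The explicit value of the commutator pairing [{f, g}] of the central extension
   of [A((t))^*] by [A^*] attached to the lattice [A[[t]]]. *)
Definition pairing_val (f g : units laurent) : A :=
  let a := wcoef f in let b := wcoef g in
  (a 0 ^ winding g * cc_prod (fun i => a i) (fun j => b (- j%:Z))) /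
  (b 0 ^ winding f * cc_prod (fun i => a (- i%:Z)) (fun j => b j)).

Lemma wcoef_unit f : wcoef f 0 \is a GRing.unit.
Proof.
rewrite /wcoef /wfactorization; case: xgetP => [wa _ [] //|_ /=].
exact: unitr1.
Qed.

Hypothesis A_local : local_ring A.

Let m_ideal : is_ideal (the_maximal_ideal (A := A)).
Proof. by case: (the_maximal_idealP A_local). Qed.

Lemma wcoef_neg f (i : nat) : (0 < i)%N -> the_maximal_ideal (wcoef f (- i%:Z)).
Proof.
move=> i0; rewrite /wcoef /wfactorization; case: xgetP => [wa _ [_ + _]|_ /=].
  by apply.
by rewrite oppr_eq0 eqz_nat eqn0Ngt i0 /=; case: m_ideal.
Qed.

Lemma ideal_exp (x : A) (n : nat) :
  (0 < n)%N -> the_maximal_ideal x -> the_maximal_ideal (x ^+ n).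
Proof.
by case: n => // n _ mx; rewrite exprSr; case: m_ideal => _ _; apply.
Qed.

Lemma cc_prod_unit (x y : nat -> A) :
    (forall i, (0 < i)%N -> the_maximal_ideal (x i)) \/
    (forall j, (0 < j)%N -> the_maximal_ideal (y j)) ->
  cc_prod x y \is a GRing.unit.
Proof.
have [_ _ mM] := m_ideal => mxy; rewrite /cc_prod.
have U1 := unitr1 A.
have UM : forall u v : A, u \is a GRing.unit -> v \is a GRing.unit ->
  u * v \is a GRing.unit by move=> u v uU vU; rewrite unitrM uU.
rewrite big_seq; elim/big_ind: _ => // i.
case: finite_supportP => // X Xsub _ _ /Xsub /= i0 {X Xsub}.
rewrite big_seq; elim/big_ind: _ => // j.
case: finite_supportP => // X Xsub _ _ /Xsub /= j0 {X Xsub}.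
have dpos k l : (0 < k)%N -> (0 < k %/ gcdn k l)%N.
  by move=> k0; rewrite divn_gt0 ?gcdn_gt0 ?k0 // dvdn_leq // dvdn_gcdl.
rewrite unitrX // maximal_ideal_unitB //; case: mxy => [mx|my].
  by rewrite mulrC; apply: mM; apply: ideal_exp; [rewrite gcdnC dpos | exact: mx].
by apply: mM; apply: ideal_exp; [rewrite dpos | exact: my].
Qed.

Lemma pairing_unit f g : pairing_val f g \is a GRing.unit.
Proof.
have expU (x : A) (n : int) : x \is a GRing.unit -> x ^ n \is a GRing.unit.
  by case: n => n xU; rewrite ?NegzE -?exprnP ?unitrV unitrX.
rewrite /pairing_val unitrM unitrV !unitrM !expU ?wcoef_unit //=.
apply/andP; split; apply: cc_prod_unit; [right|left] => i; exact: wcoef_neg.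
Qed.

Definition pairing (f g : units laurent) : units A := Units (pairing_unit f g).

Lemma cc_unit f g :
  (-1) ^ (winding f * winding g) * uval (pairing f g) \is a GRing.unit.
Proof.
rewrite unitrM uvalP andbT.
by case: (_ * _) => n; rewrite ?NegzE -?exprnP ?unitrV unitrX // unitrN1.
Qed.

Definition contou_carrere (f g : units laurent) : units A := Units (cc_unit f g).

Definition steinberg (psi : units laurent -> units laurent -> units A) : Prop :=
  bimultiplicative psi /\
  forall f g : units laurent, uval g = 1 - uval f -> psi f g = 1%g.

End Laurent.

(* Main.v *)
From HB Require Import structures.
Require Import Defs.
From mathcomp Require Import all_boot all_order all_algebra.
From mathcomp Require Import zify ring.
From mathcomp Require Import boolp classical_sets functions fsbigop.

(** Every invertible series factors uniquely as [f = t^w u k], with [u] a unit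
    of [A[[t]]] and [k] a unit of [A[t^-1]] of constant term 1. The pairing is
    therefore governed by a symbol [c(u, k)], which the explicit formula gives
    as a double product over the binomial factors of [u] and [k].

    That product becomes tractable once [c(u, k)] is recognized as a
    determinant. Let [T(f)] be the Toeplitz operator of [f], that is
    multiplication by [f] on [A((t))] compressed to [A[[t]]]. Then
    [T(f) T(g) = T(f g)] as soon as [g] is a power series or [f] a polynomial
    in [t^-1]. The commutator [T(u)^-1 T(k)^-1 T(u) T(k)] is the identity on
    [t^N A[[t]]] for large [N], so it has a determinant ([opdet]), and this is
    [c(u, k)] ([csym]). Such determinants are multiplicative and invariant under
    conjugation ([opdet_conj]), so [c] is bimultiplicative ([csymMl],
    [csymMr]). It is trivial when [u] is close to 1 ([csym_cont]), so its
    values follow from those on two binomials. Subtracting a multiple of one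
    binomial from the other changes [c] at most by a power of a constant term
    ([csym_mod_k], [csym_mod_u]); Euclid's algorithm on the exponents then yields
    [c(1 - a t^i, 1 - b t^-j) = (1 - a^(j/d) b^(i/d))^d] with [d = gcd(i, j)]
    ([csym_geom]), which is the factor of the double product. This makes the
    pairing bimultiplicative ([pairingE], [pairingMl]).

    For the Steinberg relation, [T(f)] and [T(1 - f) = 1 - T(f)] commute. When
    [w(f) >= 0] and [w(1 - f) = 0], writing both through their factors turns
    this into the identity wanted between the symbols ([csym_steinberg]). The
    remaining cases follow from antisymmetry and from [<f, -f> = 1].

    The sign [(-1)^(w w')] is the coboundary of [(-1)^(w (w - 1) / 2)], so the
    Contou-Carrere symbol lies in the class of the pairing. Conversely, let
    [mu] and [nu] be two Steinberg maps with the required properties.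
    Coboundaries on a commutative group are symmetric, so [s = mu / nu] is a
    symmetric bimultiplicative map which is trivial as soon as one of the
    winding numbers vanishes. It is then determined by
    [s(t, t) = s(t, -1) s(t, -t)], where the first factor is trivial because
    [w(-1) = 0] and the second because [-t = (1 - t) / (1 - t^-1)] ([steinberg_uniq]). *)

Set Implicit Arguments.
Unset Strict Implicit.
Unset Printing Implicit Defensive.

Import Order.TTheory GRing.Theory Num.Theory.

Local Open Scope ring_scope.

(** * Determinants of operators that are the identity on a tail *)

Lemma det_1addMC (R : comNzRingType) m n (B : 'M[R]_(m, n)) (C : 'M[R]_(n, m)) :
  \det (1%:M + B *m C) = \det (1%:M + C *m B).
Proof.
pose M := block_mx 1%:M (- B) C 1%:M.
have E1 : block_mx 1%:M B 0 1%:M *m M = block_mx (1%:M + B *m C) 0 C 1%:M.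
  by rewrite mulmx_block !mul1mx !mulmx1 !mul0mx !add0r addNr.
have E2 : M *m block_mx 1%:M B 0 1%:M = block_mx 1%:M 0 C (1%:M + C *m B).
  by rewrite mulmx_block !mulmx1 !mul1mx !mulmx0 !addr0 subrr [1%:M + _]addrC.
have := congr1 (@determinant _ _) E2; have := congr1 (@determinant _ _) E1.
rewrite !det_mulmx !det_lblock !det_ublock !det1 !mul1r !mulr1 => -> .
by [].
Qed.

Section Operators.
Variable A : comUnitRingType.
(** Power series as sequences of coefficients; [A^o] is [A] as a module over
    itself. *)
Notation V := (nat -> A^o).
Implicit Types (X Y : {linear V -> V}) (x y : V) (N : nat).

Definition vmonom (j : nat) : V := fun i => (i == j)%:R.
Definition vge N x := forall i, (i < N)%N -> x i = 0.
Definition tail N x : V := fun i => if (i < N)%N then 0 else x i.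

Lemma tail_vge N x : vge N (tail N x).
Proof. by move=> i iN; rewrite /tail iN. Qed.

Lemma vmonom_vge N j : (N <= j)%N -> vge N (vmonom j).
Proof. by move=> Nj i iN; rewrite /vmonom; case: eqP => //; lia. Qed.

Lemma vgeW N M x : (N <= M)%N -> vge M x -> vge N x.
Proof. by move=> NM xM i iN; apply: xM; lia. Qed.

Lemma vaddE x y i : (x + y) i = x i + y i.
Proof. by []. Qed.

Lemma vsubE x y i : (x - y) i = x i - y i.
Proof. by []. Qed.

Lemma vscaleE (c : A) x i : (c *: x) i = c * x i.
Proof. by []. Qed.

Lemma sum_vmonom (I : Type) (r : seq I) (P : pred I) (F : I -> V) i :
  (\sum_(j <- r | P j) F j) i = \sum_(j <- r | P j) F j i.
Proof. by elim/big_rec2: _ => // j y z _ <-. Qed.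

Lemma vdecomp N x : x = \sum_(j < N) x j *: vmonom j + tail N x.
Proof.
apply: funext => i; rewrite vaddE sum_vmonom /tail.
case: ltnP => iN.
  rewrite (bigD1 (Ordinal iN)) //= big1 => [|j]; last first.
    rewrite -val_eqE /= => ji; rewrite vscaleE /vmonom.
    by rewrite eq_sym (negbTE ji) mulr0.
  by rewrite vscaleE /vmonom eqxx mulr1 !addr0.
rewrite big1 ?add0r // => j _; rewrite vscaleE /vmonom.
by case: eqP => [|_]; [have := ltn_ord j; lia | rewrite mulr0].
Qed.

Definition block N (X : V -> V) : 'M[A]_N := \matrix_(i, j) X (vmonom j) i.

Lemma lin_decomp N X x i :
  X x i = \sum_(j < N) X (vmonom j) i * x j + X (tail N x) i.
Proof.
rewrite {1}[x](vdecomp N) linearD linear_sum vaddE sum_vmonom.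
by congr (_ + _); apply: eq_bigr => j _; rewrite linearZ_LR vscaleE mulrC.
Qed.

Lemma block_comp N X Y :
  (forall x, vge N x -> vge N (X x)) -> block N (X \o Y) = block N X *m block N Y.
Proof.
move=> XN; apply/matrixP => i j; rewrite !mxE /= (lin_decomp N).
rewrite [X (tail _ _) _]XN //; last exact: tail_vge.
by rewrite addr0; apply: eq_bigr => l _; rewrite !mxE.
Qed.

Definition fixes N (X : V -> V) := forall x, vge N x -> X x = x.

Lemma fixesW N M X : (N <= M)%N -> fixes N X -> fixes M X.
Proof. by move=> NM XN x xM; apply: XN; apply: vgeW xM. Qed.

Lemma fixes_comp N X Y : fixes N X -> fixes N Y -> fixes N (X \o Y).
Proof. by move=> XN YN x xN /=; rewrite YN // XN. Qed.

Lemma det_block_fixes N M (X : V -> V) : fixes N X ->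
  \det (block (N + M) X) = \det (block N X).
Proof.
move=> XN.
suff -> : block (N + M) X =
    block_mx (block N X) 0 (\matrix_(i, j) X (vmonom j) (N + i)%N) 1%:M.
  by rewrite det_lblock det1 mulr1.
apply/matrixP => i j; rewrite !mxE.
case: splitP => i' ->; rewrite !mxE; case: splitP => j' ->; rewrite !mxE //.
  rewrite XN; last by apply: vmonom_vge; lia.
  by rewrite /vmonom; case: eqP => //; have := ltn_ord i'; lia.
rewrite XN; last by apply: vmonom_vge; lia.
by rewrite /vmonom eqn_add2l.
Qed.

(** Any [N] such that [fixes N X] gives the same value, by [opdetE]. *)
Definition opdet (X : V -> V) : A :=
  \det (block (xget 0 [set N | fixes N X]%classic) X).

Lemma opdetE N (X : V -> V) : fixes N X -> opdet X = \det (block N X).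
Proof.
move=> XN; rewrite /opdet; set M := xget _ _.
have XM : fixes M X by exact: (@xgetI _ 0%N [set N | fixes N X]%classic N).
have [le|/ltnW le] := leqP N M.
  by rewrite -(subnKC le) det_block_fixes.
by rewrite -(subnKC le) det_block_fixes.
Qed.

Lemma opdetM N X Y : fixes N X -> fixes N Y ->
  opdet (X \o Y) = opdet X * opdet Y.
Proof.
move=> XN YN; rewrite (opdetE (fixes_comp XN YN)) (opdetE XN) (opdetE YN).
by rewrite block_comp ?det_mulmx // => x xN; rewrite XN.
Qed.

(** If [X = 1 + E] and [E] kills [t^N A[[t]]], then [E] and [g E h] factor
    through [A^N], with matrices [C B] and [B C] respectively; hence the claim
    reduces to [det (1 + B C) = det (1 + C B)]. *)
Lemma opdet_conj N M X (g h : {linear V -> V}) :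
    cancel g h -> cancel h g -> fixes N X ->
    (forall x, vge M x -> vge N (h x)) ->
  fixes M (g \o X \o h) /\ opdet (g \o X \o h) = opdet X.
Proof.
move=> gK hK XN hM.
have YM : fixes M (g \o X \o h) by move=> x xM /=; rewrite XN ?hK //; exact: hM.
split=> //; rewrite (opdetE YM) (opdetE XN).
pose B : 'M[A]_(M, N) := \matrix_(i, j) g (X (vmonom j) - vmonom j) i.
pose C : 'M[A]_(N, M) := \matrix_(i, j) h (vmonom j) i.
have blk1 n i j : (1%:M : 'M[A]_n) i j = vmonom j i by rewrite mxE /vmonom.
have -> : block M (g \o X \o h) = 1%:M + B *m C.
  apply/matrixP => i j; rewrite [RHS]mxE blk1 !mxE /=.
  have -> : g (X (h (vmonom j))) i
      = vmonom j i + (g \o (X \- idfun)) (h (vmonom j)) i.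
    rewrite /= linearB /= hK vsubE; ring.
  congr (_ + _); rewrite (lin_decomp N) /= [X in g (X - _)]XN; last exact: tail_vge.
  rewrite subrr linear0 addr0; apply: eq_bigr => l _; by rewrite !mxE.
rewrite det_1addMC; congr (\det _); apply/matrixP => i j; rewrite [LHS]mxE blk1 !mxE.
have -> : \sum_k C i k * B k j = h (g (X (vmonom j) - vmonom j)) i.
  rewrite (lin_decomp M) [h (tail _ _) _]hM ?addr0; [|exact: tail_vge|exact: ltn_ord].
  by apply: eq_bigr => l _; rewrite !mxE.
by rewrite gK vsubE; ring.
Qed.

Lemma opdet_unip N (X : V -> V) : fixes N X ->
  (forall j i, (j <= i)%N -> X (vmonom j) i = vmonom j i) -> opdet X = 1.
Proof.
move=> XN Xu; rewrite (opdetE XN) -det_tr det_trig.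
  by apply: big1 => i _; rewrite !mxE Xu // /vmonom eqxx.
apply/is_trig_mxP => i j ij; rewrite !mxE Xu; last exact: ltnW.
by rewrite /vmonom; case: eqP => //; lia.
Qed.

Lemma det_block_lower N (X : V -> V) c :
  (forall j i, (i <= j)%N -> X (vmonom j) i = c * vmonom j i) ->
  \det (block N X) = c ^+ N.
Proof.
move=> Xu; rewrite det_trig.
  rewrite (eq_bigr (fun=> c)) ?prodr_const ?card_ord // => i _.
  by rewrite mxE Xu // /vmonom eqxx mulr1.
apply/is_trig_mxP => i j ij; rewrite !mxE Xu; last exact: ltnW.
by rewrite /vmonom; case: eqP => [|_]; [lia|rewrite mulr0].
Qed.

End Operators.

(** * Supports of Laurent series *)
Section Coefficients.
Variable A : comUnitRingType.
Notation L := (laurent A).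
Implicit Types (f g u k : L).

Definition lge (a : int) f := forall n : int, n < a -> f n = 0.
Definition lle (a : int) f := forall n : int, a < n -> f n = 0.
Notation pos := (lge 0).
Notation neg := (lle 0).

Lemma lcoef1 n : (1 : L) n = (n == 0)%:R.
Proof. by rewrite /= ; case: (n == 0). Qed.

Lemma lcoef_sum (I : Type) (r : seq I) (P : pred I) (F : I -> L) n :
  (\sum_(j <- r | P j) F j) n = \sum_(j <- r | P j) F j n.
Proof. by elim/big_rec2: _ => [|j y z _ <-]; [rewrite /= if_same|]. Qed.

Lemma lcoefM_sum f g a b n (M : nat) : lge a f -> lge b g -> n < a + b + M%:Z ->
  (f * g) n = \sum_(k < M) f (a + k%:Z) * g (n - (a + k%:Z)).
Proof. by move=> fa gb ltn; exact: (lmul_coefE fa gb ltn). Qed.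

Lemma lge_ex f : exists a, lge a f.
Proof. exact: lcoef_bounded. Qed.

Lemma lgeW a b f : b <= a -> lge a f -> lge b f.
Proof. by move=> ba fa n nb; apply: fa; lia. Qed.

Lemma lleW a b f : a <= b -> lle a f -> lle b f.
Proof. by move=> ba fa n nb; apply: fa; lia. Qed.

Lemma lge_bound (f : L) : exists n : nat, lge (- n%:Z) f.
Proof. by have [a fa] := lge_ex f; exists (absz a); apply: lgeW fa; lia. Qed.

Lemma lge1 : pos (1 : L).
Proof. by move=> n n0; rewrite lcoef1; case: eqP => //; lia. Qed.
Lemma lle1 : neg (1 : L).
Proof. by move=> n n0; rewrite lcoef1; case: eqP => //; lia. Qed.

Lemma lgeD a f g : lge a f -> lge a g -> lge a (f + g).
Proof. by move=> fa ga n na; rewrite lcoefD fa ?ga ?addr0. Qed.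
Lemma lgeN a f : lge a f -> lge a (- f).
Proof. by move=> fa n na; rewrite lcoefN fa ?oppr0. Qed.
Lemma lleD a f g : lle a f -> lle a g -> lle a (f + g).
Proof. by move=> fa ga n na; rewrite lcoefD fa ?ga ?addr0. Qed.
Lemma lleN a f : lle a f -> lle a (- f).
Proof. by move=> fa n na; rewrite lcoefN fa ?oppr0. Qed.

Lemma lgeM a b f g : lge a f -> lge b g -> lge (a + b) (f * g).
Proof. by move=> fa gb; exact: (lmul_bound fa gb). Qed.

Lemma lcoefM_low a b f g : lge a f -> lge b g -> (f * g) (a + b) = f a * g b.
Proof.
move=> fa gb; rewrite (lcoefM_sum (M := 1) fa gb); last by lia.
by rewrite big_ord1 addr0; congr (_ * g _); lia.
Qed.

Lemma lleM a b f g : lle a f -> lle b g -> lle (a + b) (f * g).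
Proof.
move=> fa gb n ltn; have [c fc] := lge_ex f; have [d gd] := lge_ex g.
rewrite (lcoefM_sum (M := (absz (n - (c + d))%R).+1) fc gd); last by lia.
apply: big1 => i _; have [le|lt] := leP (c + i%:Z) a; last by rewrite fa ?mul0r.
by rewrite gb ?mulr0 //; lia.
Qed.

Lemma lcoefM_high a b f g : lle a f -> lle b g -> (f * g) (a + b) = f a * g b.
Proof.
move=> fa gb; have [c0 fc0] := lge_ex f; have [d gd] := lge_ex g.
pose c := Num.min c0 a; have fc : lge c f by apply: lgeW fc0; rewrite /c; lia.
rewrite (lcoefM_sum (M := (absz (a - c)%R + absz (a + b - (c + d))%R).+1) fc gd); last by lia.
have lt : (absz (a - c) < (absz (a - c)%R + absz (a + b - (c + d))%R).+1)%N by lia.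
have e : c + (absz (a - c))%:Z = a by rewrite /c; lia.
rewrite (bigD1 (Ordinal lt)) //= e addrAC subrr add0r big1 ?addr0 // => i.
rewrite -val_eqE /= => /eqP ne.
have [le|ltn] := leP (c + i%:Z) a; last by rewrite fa ?mul0r.
by rewrite gb ?mulr0 //; lia.
Qed.

Lemma lcoef_monom (c : A) d n : lmonom c d n = if n == d then c else 0.
Proof. by []. Qed.

Lemma lge_monom (c : A) a d : a <= d -> lge a (lmonom c d).
Proof. by move=> ad n na; rewrite /=; case: eqP => //; lia. Qed.
Lemma lle_monom (c : A) a d : d <= a -> lle a (lmonom c d).
Proof. by move=> ad n na; rewrite /=; case: eqP => //; lia. Qed.

Lemma lcoef_monomM (c : A) d f n : (lmonom c d * f) n = c * f (n - d).
Proof.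
have [a fa] := lge_ex f.
have := lge_monom c (lexx d) => md.
have [lt|le] := ltP n (d + a).
  by rewrite (lgeM md fa) // fa ?mulr0 //; lia.
rewrite (lcoefM_sum (M := (absz (n - (d + a))%R).+1) md fa); last by lia.
rewrite big_ord_recl /= addr0 eqxx big1 ?addr0 // => i _.
by rewrite /bump /= ; case: eqP => [|_]; [lia|rewrite mul0r].
Qed.

Lemma lmonomM (c c' : A) d d' : lmonom c d * lmonom c' d' = lmonom (c * c') (d + d').
Proof.
apply: laurentP => n; rewrite lcoef_monomM /=.
have -> : (n - d == d') = (n == d + d') by lia.
by case: ifP => // _; rewrite mulr0.
Qed.

Lemma lmonom1 : lmonom 1 0 = 1 :> L. Proof. by []. Qed.

Lemma lmonomN (c : A) d : lmonom (- c) d = - lmonom c d.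
Proof. by apply: laurentP => n /=; case: eqP => //; rewrite oppr0. Qed.

Lemma lmonom0 d : lmonom 0 d = 0 :> L.
Proof. by apply: laurentP => n /=; rewrite !if_same. Qed.

Lemma lmonomX (c : A) d s : lmonom c d ^+ s = lmonom (c ^+ s) (d *+ s).
Proof.
elim: s => [|s IHs]; first by rewrite !expr0 mulr0n.
by rewrite !exprS IHs lmonomM mulrS.
Qed.

Lemma lmonom_unit (c : A) d : c \is a GRing.unit -> lmonom c d \is a GRing.unit.
Proof.
move=> cU; apply/unitrPr; exists (lmonom c^-1 (- d)).
by rewrite lmonomM divrr // subrr.
Qed.

Lemma lmonom1_unit d : (lmonom 1 d : L) \is a GRing.unit.
Proof. exact: lmonom_unit (unitr1 _). Qed.

Definition isU u := [/\ pos u, u 0 \is a GRing.unit & u \is a GRing.unit].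

(** The lowest coefficient of [u u^-1] is [u_0] times that of [u^-1], which
    raises the lower bound on the support of [u^-1] as long as it is negative. *)
Lemma pos_inv u : isU u -> pos u^-1.
Proof.
move=> [up u0 uU]; have [n] := lge_bound u^-1.
elim: n => [|n IHn]; first by rewrite oppr0.
move=> gn; apply: IHn => m mn.
have [lt|le] := ltP m (- (n.+1)%:Z); first exact: gn.
have -> : m = 0 + - (n.+1)%:Z by lia.
have := lcoefM_low up gn; rewrite divrr // lcoef1 add0r.
have -> : (- (n.+1)%:Z == 0) = false by lia.
by move/(congr1 ( *%R (u 0)^-1)); rewrite mulr0 mulKr.
Qed.

Lemma lcoef0_inv u : isU u -> u^-1 0 = (u 0)^-1.
Proof.
move=> uU; have up := pos_inv uU; case: uU => [u_pos u0 uU].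
have := lcoefM_low u_pos up; rewrite divrr // lcoef1 addr0 eqxx.
by move/(congr1 ( *%R (u 0)^-1)); rewrite mulr1 mulKr.
Qed.

Lemma isUV u : isU u -> isU u^-1.
Proof. by move=> uU; split; rewrite ?lcoef0_inv ?unitrV //; [exact: pos_inv|case: uU..]. Qed.

Lemma posM f g : pos f -> pos g -> pos (f * g).
Proof. by move=> fp gp; rewrite -[0]addr0; apply: lgeM. Qed.

Lemma negM f g : neg f -> neg g -> neg (f * g).
Proof. by move=> fp gp; rewrite -[0]addr0; apply: lleM. Qed.

Lemma posM0 f g : pos f -> pos g -> (f * g) 0 = f 0 * g 0.
Proof. by move=> fp gp; rewrite -{1}[0]addr0 lcoefM_low. Qed.

Lemma negM0 f g : neg f -> neg g -> (f * g) 0 = f 0 * g 0.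
Proof. by move=> fp gp; rewrite -{1}[0]addr0 lcoefM_high. Qed.

Lemma isUM u v : isU u -> isU v -> isU (u * v).
Proof.
move=> [up u0 uU] [vp v0 vU]; split; rewrite ?unitrM ?uU ?posM0 ?unitrM ?u0 //.
exact: posM.
Qed.

Lemma isU_monom (c : A) : c \is a GRing.unit -> isU (lmonom c 0).
Proof. by move=> cU; split; rewrite ?lmonom_unit //; exact: lge_monom. Qed.

(** Units of [A[t^-1]] with constant term 1. That the other coefficients are
    nilpotent is encoded by the inverse having no positive exponents: every
    Laurent series is bounded below, so this inverse is a polynomial in [t^-1]. *)
Definition isK k := [/\ neg k, neg k^-1, k 0 = 1 & k \is a GRing.unit].

Lemma lcoef0_Kinv k : isK k -> k^-1 0 = 1.
Proof.
move=> [kn kn' k0 kU]; have := negM0 kn kn'.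
by rewrite divrr // lcoef1 eqxx k0 mul1r.
Qed.

Lemma isKV k : isK k -> isK k^-1.
Proof. by move=> kK; split; rewrite ?invrK ?lcoef0_Kinv ?unitrV //; case: kK. Qed.

Lemma isKM h k : isK h -> isK k -> isK (h * k).
Proof.
move=> [hn hn' h0 hU] [kn kn' k0 kU]; split; rewrite ?unitrM ?hU ?negM0 ?h0 ?k0 ?mulr1 //.
  exact: negM.
by rewrite invrM //; apply: negM.
Qed.

Lemma isU1 : isU 1.
Proof. by split; rewrite ?lcoef1 ?unitr1 //; exact: lge1. Qed.
Lemma isK1 : isK 1.
Proof. by split; rewrite ?invr1 ?lcoef1 ?unitr1 //; exact: lle1. Qed.

(** The coefficient [a] is arbitrary, so the inverse is an infinite geometric
    series, given by its coefficients. *)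
Lemma geom_unit (a : A) (i : nat) : (0 < i)%N -> (1 - lmonom a i : L) \is a GRing.unit.
Proof.
move=> i0.
have bnd : exists b : int, forall n : int, n < b ->
    (if (0 <= n) && (i %| `|n|)%N then a ^+ (`|n| %/ i)%N else 0) = 0.
  by exists 0 => n n0; rewrite leNgt n0.
apply/unitrPr; exists (Laurent bnd); apply: laurentP => n.
rewrite mulrBl mul1r lcoefD lcoefN lcoef_monomM lcoef1 /=.
have [->|n0] := eqVneq n 0.
  have -> : (0 <= 0 - i%:Z) = false by lia.
  by rewrite /= dvdn0 div0n expr0 mulr0 subr0.
have [lt|le] := ltP n 0; first by rewrite /= ifF ?mulr0 ?subr0 //; lia.
rewrite /=; have [lt|le'] := ltP n i%:Z.
  rewrite ifF; last first.
    apply/negP => /dvdn_leq; lia.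
  by rewrite ifF ?mulr0 ?subr0 //; lia.
have -> : `|n|%N = (i + `|n - i%:Z|)%N by lia.
rewrite dvdn_addr // divnDl // divnn i0 add1n exprS subr_ge0 le' /=.
by case: ifP; rewrite ?mulr0 subrr.
Qed.

Lemma isU_geom (a : A) (i : nat) : (0 < i)%N -> isU (1 - lmonom a i).
Proof.
move=> i0; split; last exact: geom_unit.
  by apply: lgeD; [exact: lge1 | apply/lgeN/lge_monom].
rewrite lcoefD lcoefN lcoef1 lcoef_monom eqxx ifF ?subr0 ?unitr1 //; lia.
Qed.

Lemma isK_nil f M : lle (-1) f -> f ^+ M = 0 -> isK (1 - f).
Proof.
move=> fn fM.
have fX s : neg (f ^+ s).
  elim: s => [|s IHs]; first by rewrite expr0; exact: lle1.
  by rewrite exprS; apply: negM => //; apply: lleW fn.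
have e : (1 - f) * (\sum_(i < M) f ^+ i) = 1.
  by rewrite -opprB mulNr -subrX1 fM sub0r opprK.
have uU : 1 - f \is a GRing.unit by apply/unitrPr; exists (\sum_(i < M) f ^+ i).
have eV : (1 - f)^-1 = \sum_(i < M) f ^+ i.
  by apply: (mulrI uU); rewrite divrr // e.
split=> //.
- by apply: lleD; [exact: lle1 | apply/lleN/(lleW _ fn)].
- rewrite eV => n n0; rewrite lcoef_sum; apply: big1 => i _; exact: fX.
- by rewrite lcoefD lcoefN lcoef1 fn // subr0.
Qed.

Lemma isK_geom (b : A) (j M : nat) : (0 < j)%N -> b ^+ M = 0 ->
  isK (1 - lmonom b (- j%:Z)).
Proof.
move=> j0 bM; apply: (@isK_nil _ M); first by apply: lle_monom; lia.
by rewrite lmonomX bM lmonom0.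
Qed.

End Coefficients.
Notation pos := (lge 0).
Notation neg := (lle 0).

(** * Toeplitz operators *)
Section Toeplitz.
Variable A : comUnitRingType.
Notation L := (laurent A).
Notation V := (nat -> A^o).
Implicit Types (f g u k : L) (x : V).

#[local] Obligation Tactic := idtac.
Program Definition emb (x : V) : L :=
  Laurent (lcoef := fun n => if 0 <= n then x `|n|%N : A else 0) _.
Next Obligation. by move=> x; exists 0 => n n0; rewrite leNgt n0. Qed.

Lemma emb_pos x : pos (emb x).
Proof. by move=> n n0 /=; rewrite leNgt n0. Qed.

Lemma embE x (n : nat) : emb x n%:Z = x n.
Proof. by []. Qed.

Lemma emb_monom j : emb (vmonom _ j) = lmonom 1 j%:Z.
Proof.
apply: laurentP => n /=; rewrite /vmonom.
case: n => n /=; last by [].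
by rewrite eqz_nat; case: eqP.
Qed.

Definition toep f : V -> V := fun x n => (f * emb x) n%:Z.

Fact toep_linear f : linear (toep f).
Proof.
move=> c x y; apply: funext => n.
rewrite vaddE vscaleE /toep.
have -> : emb (c *: x + y) = lmonom c 0 * emb x + emb y.
  apply: laurentP => m; rewrite lcoefD lcoef_monomM subr0 /=.
  by case: ifP => // _; rewrite mulr0 addr0.
by rewrite mulrDr mulrCA lcoefD lcoef_monomM subr0.
Qed.

HB.instance Definition _ f := GRing.isLinear.Build A V V _ (toep f) (toep_linear f).

Lemma toepE f x n : toep f x n = (f * emb x) n%:Z.
Proof. by []. Qed.

Lemma toep1 x : toep 1 x = x.
Proof. by apply: funext => n; rewrite toepE mul1r. Qed.

Lemma emb_toep f x : pos (f * emb x) -> emb (toep f x) = f * emb x.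
Proof.
move=> fp; apply: laurentP => n; have [n0|n0] := leP 0 n.
  by rewrite /= n0 /toep gez0_abs.
by rewrite emb_pos // fp.
Qed.

(** Nothing is lost by compressing the intermediate result when it is already
    a power series. *)
Lemma toepM_pos f g x : pos (g * emb x) -> toep f (toep g x) = toep (f * g) x.
Proof. by move=> gp; apply: funext => n; rewrite !toepE emb_toep // mulrA. Qed.

Lemma toepMr f g x : pos g -> toep f (toep g x) = toep (f * g) x.
Proof. by move=> gp; apply: toepM_pos; apply: posM => //; exact: emb_pos. Qed.

(** Multiplication by [f] keeps the discarded negative exponents negative. *)
Lemma toepMl f g x : neg f -> toep f (toep g x) = toep (f * g) x.
Proof.
move=> fn; apply: funext => n; rewrite !toepE -mulrA.
have d : lle (-1) (emb (toep g x) - g * emb x).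
  move=> m lm; have m0 : 0 <= m by lia.
  by rewrite lcoefD lcoefN /= m0 /toep gez0_abs // subrr.
have : (f * (emb (toep g x) - g * emb x)) n = 0 by rewrite (lleM fn d) //; lia.
by rewrite mulrBr lcoefD lcoefN => /eqP; rewrite subr_eq0 => /eqP.
Qed.

Lemma toepK f x : pos f \/ neg f^-1 -> f \is a GRing.unit -> toep f^-1 (toep f x) = x.
Proof.
by move=> [fp|fn] fU; rewrite ?(toepMr _ _ fp) ?(toepMl _ _ fn) mulVr // toep1.
Qed.

Lemma toep0 x : toep 0 x = 0.
Proof. by apply: funext => n; rewrite toepE mul0r /= if_same. Qed.

Lemma toepD f g x : toep (f + g) x = toep f x + toep g x.
Proof. by apply: funext => n; rewrite vaddE !toepE mulrDl. Qed.

Lemma toepN f x : toep (- f) x = - toep f x.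
Proof. by apply: funext => n; rewrite toepE mulNr. Qed.

Lemma emb_ge N x : vge N x -> lge N%:Z (emb x).
Proof. by move=> xN [n|n] nN //=; apply: xN; rewrite -ltz_nat. Qed.

Lemma toep_ge (a : int) (N M : nat) f x : lge a f -> M%:Z <= a + N%:Z ->
  vge N x -> vge M (toep f x).
Proof.
move=> fa le xN i iM; rewrite toepE.
by rewrite (lgeM fa (emb_ge xN)) //; lia.
Qed.

Lemma toep_le (a b : int) f x : lle a f -> lle b (emb x) ->
  lle (a + b) (emb (toep f x)).
Proof.
move=> fa xb n ltn; have [n0|n0] := leP 0 n; last exact: emb_pos.
by rewrite /= n0 /toep gez0_abs // (lleM fa xb).
Qed.

(** An operator [T(k)] with [k] in [1 + t^-1 A[t^-1]] is upper unitriangular. *)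
Lemma toep_top k x (j m : nat) : neg k -> k 0 = 1 ->
  (forall l, (j <= l)%N -> x l = vmonom A j l) -> (j <= m)%N ->
  toep k x m = vmonom A j m.
Proof.
move=> kn k0 xj jm.
have xle : lle j%:Z (emb x).
  case=> l //= jl; rewrite xj; last by lia.
  by rewrite /vmonom; case: eqP => //; lia.
rewrite toepE /vmonom; have [->|/eqP ne] := eqVneq m j.
  have := lcoefM_high kn xle; rewrite add0r => ->.
  by rewrite k0 mul1r embE xj // /vmonom eqxx.
by rewrite (lleM kn xle) //; lia.
Qed.

Lemma det_toep n u : pos u -> \det (block n (toep u)) = u 0 ^+ n.
Proof.
move=> up; rewrite (@det_block_lower _ n _ (u 0)) // => j i ij.
rewrite toepE emb_monom mulrC lcoef_monomM mul1r /vmonom.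
case: (eqVneq i j) => [->|/eqP ne]; first by rewrite subrr mulr1.
by rewrite mulr0 up //; lia.
Qed.

End Toeplitz.

(** * The commutator symbol *)
Section Symbol.
Variable A : comUnitRingType.
Notation L := (laurent A).
Notation V := (nat -> A^o).
Implicit Types (f g u v h k : L) (x : V).

Definition comm u k : V -> V := toep u^-1 \o toep k^-1 \o toep u \o toep k.
HB.instance Definition _ u k := GRing.Linear.copy (comm u k)
  (toep u^-1 \o toep k^-1 \o toep u \o toep k).

Lemma commE u k x : comm u k x = toep u^-1 (toep k^-1 (toep u (toep k x))).
Proof. by []. Qed.

Definition csym u k : A := opdet (comm u k).

Lemma toepUK u x : isU u -> toep u^-1 (toep u x) = x.
Proof. by case=> up _ uU; apply: toepK => //; left. Qed.
Lemma toepUVK u x : isU u -> toep u (toep u^-1 x) = x.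
Proof. by move=> uU; rewrite -{1}[u]invrK toepUK //; exact: isUV. Qed.
Lemma toepKK k x : isK k -> toep k^-1 (toep k x) = x.
Proof. by case=> kn kn' _ kU; apply: toepK => //; right. Qed.
Lemma toepKVK k x : isK k -> toep k (toep k^-1 x) = x.
Proof. by move=> uU; rewrite -{1}[k]invrK toepKK //; exact: isKV. Qed.

(** On [t^N A[[t]]] multiplication by [k] is not truncated, so
    [T(u) T(k)] acts there as [T(k) T(u)]. *)
Lemma comm_fixes N u k : isU u -> isK k -> lge (- N%:Z) k -> fixes N (comm u k).
Proof.
move=> uU kK kN x xN; rewrite /= !commE.
have p : pos (k * emb x).
  have := lgeM kN (emb_ge xN); apply: lgeW; lia.
rewrite (toepM_pos u p).
case: (kK) => _ kn _ kU.
by rewrite (toepMl _ _ kn) mulrCA mulVr // mulr1 toepUK.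
Qed.

Lemma csymE N u k : isU u -> isK k -> lge (- N%:Z) k ->
  csym u k = \det (block N (comm u k)).
Proof. by move=> uU kK kN; apply: opdetE; exact: comm_fixes. Qed.

(** The commutator identity
    [[u1 u2, k] = u2^-1 [u1, k] u2 . [u2, k]] and conjugation invariance. *)
Lemma csymMl u1 u2 k : isU u1 -> isU u2 -> isK k ->
  csym (u1 * u2) k = csym u1 k * csym u2 k.
Proof.
move=> U1 U2 kK; have [N kN] := lge_bound k.
have f1 := comm_fixes U1 kK kN; have f2 := comm_fixes U2 kK kN.
have [] := @opdet_conj _ N N (comm u1 k) (toep u2^-1) (toep u2) _ _ f1.
- by move=> x; exact: toepUVK.
- by move=> x; exact: toepUK.
- by move=> x xN; apply: (toep_ge (a := 0)) xN; [case: U2|lia].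
move=> f3 d3; rewrite /csym -d3 -(opdetM f3 f2); congr opdet; apply: funext => x.
case: (U1) => p1 _ u1U; case: (U2) => p2 _ u2U.
rewrite /= !commE (toepUVK _ U2) (toepKVK _ kK).
rewrite (toepMr u1 _ p2) (toepMr (u2^-1) _ (pos_inv U1)) -invrM //.
Qed.

(** Here the conjugating operator [T(k2)] lowers exponents, so the conjugate
    fixes a smaller tail than the commutator itself. *)
Lemma csymMr u k1 k2 : isU u -> isK k1 -> isK k2 ->
  csym u (k1 * k2) = csym u k1 * csym u k2.
Proof.
move=> uU K1 K2; have [N1 kN1] := lge_bound k1; have [N2 kN2] := lge_bound k2.
have f1 := comm_fixes uU K1 kN1; have f2 := comm_fixes uU K2 kN2.
have [] := @opdet_conj _ N1 (N1 + N2) (comm u k1) (toep k2^-1) (toep k2) _ _ f1.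
- by move=> x; exact: toepKVK.
- by move=> x; exact: toepKK.
- by move=> x xN; apply: (toep_ge (a := - N2%:Z)) xN; [case: K2|lia].
move=> f3 d3; have {}f2 := fixesW (leq_addl N1 N2) f2.
rewrite /csym -d3 [RHS]mulrC -(opdetM f2 f3); congr opdet; apply: funext => x.
case: (K1) => n1 n1' _ k1U; case: (K2) => n2 n2' _ k2U.
rewrite /= !commE (toepKVK _ K2) (toepUVK _ uU).
rewrite (toepMl _ _ n1) (toepMl _ _ n2') -invrM //.
Qed.

Lemma csym_const (a : A) k : a \is a GRing.unit -> isK k -> csym (lmonom a 0) k = 1.
Proof.
move=> aU kK; have aUU := isU_monom aU.
have e x : comm (lmonom a 0) k x = x.
  have lin y : toep (lmonom a 0) y = a *: y.
    by apply: funext => n; rewrite toepE lcoef_monomM subr0.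
  rewrite /= !commE lin linearZ_LR /= (toepKK _ kK) -lin; exact: toepUK.
have f0 : fixes 0 (comm (lmonom a 0) k) by move=> x _; exact: e.
by rewrite /csym (opdetE f0) det_mx00.
Qed.

Lemma csym1l k : isK k -> csym 1 k = 1.
Proof. exact: (csym_const (unitr1 A)). Qed.

Lemma csym1r u : isU u -> csym u 1 = 1.
Proof.
move=> uU; have kK := isK1 A; rewrite (@csymE 0) ?det_mx00 // oppr0; exact: lge1.
Qed.

Lemma csym_unit u k : isU u -> isK k -> csym u k \is a GRing.unit.
Proof.
move=> uU kK; apply/unitrPr; exists (csym u^-1 k).
by rewrite -csymMl ?divrr ?csym1l //; [case: uU|exact: isUV].
Qed.

(** This says that [c(v, k)] depends only on [v] modulo the polynomial
    [t^n k], up to a power of the constant term: [T(k)^-1 T(v) T(k)] equals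
    [1 + T(y) T(k)], which is the identity modulo [t^n], so that only the block
    of [T(v)^-1] contributes. *)
Lemma csym_mod_k (n : nat) v k y : isU v -> isK k -> lge (- n%:Z) k ->
  lge n%:Z y -> v = 1 + k * y -> csym v k = (v 0)^-1 ^+ n.
Proof.
move=> vU kK kn yn ve; rewrite (csymE vU kK kn).
have vUV := isUV vU; case: (kK) => kneg kneg' _ kU.
rewrite -(lcoef0_inv vU) -det_toep; last exact: pos_inv.
congr (\det _); apply/matrixP => i j; rewrite !mxE /comm /=.
have yp : pos y by apply: lgeW yn.
have -> : toep k^-1 (toep v (toep k (vmonom A j))) =
    vmonom A j + toep y (toep k (vmonom A j)).
  rewrite ve toepD toep1 linearD /= (toepKK _ kK) -(toepMr _ _ yp).
  by rewrite (toepKK _ kK).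
rewrite linearD vaddE -[RHS]addr0; congr (_ + _).
apply: (@toep_ge _ 0 n n (v^-1)) => //; first exact: pos_inv.
by apply: (toep_ge yn (N := 0)); rewrite ?addr0.
Qed.

(** The mirror image of [csym_mod_k], for [k] modulo [u]: the conjugate
    [T(u) T(k) T(u)^-1] equals [1 + T(u) T(y)], and [T(u) T(y)] strictly lowers
    exponents, so after multiplication by [T(k)^-1] the commutator is upper
    unitriangular. *)
Lemma csym_mod_u (i : int) u k y : isU u -> isK k -> lle i u ->
  lle (- i - 1) y -> k = 1 + u * y -> csym u k = 1.
Proof.
move=> uU kK ui yi ke; have [N kN] := lge_bound k.
have fN := comm_fixes uU kK kN; case: (uU) => up _ _; case: (kK) => kn kn' k0 kU.
have [] := @opdet_conj _ N N (comm u k) (toep u) (toep u^-1) _ _ fN.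
- by move=> x; exact: toepUK.
- by move=> x; exact: toepUVK.
- by move=> x xN; apply: (toep_ge (a := 0)) xN; [exact: pos_inv|lia].
move=> f3; rewrite -/(csym u k) => <-; apply: (opdet_unip f3) => j m jm.
rewrite /= !commE (toepUVK _ uU) ke toepD toep1 [u * y]mulrC -(toepMr _ _ up).
rewrite (toepUVK _ uU) linearD /= (toepUVK _ uU) [y * u]mulrC -ke.
apply: toep_top => //; first exact: lcoef0_Kinv.
move=> l jl; rewrite vaddE -[RHS]addr0; congr (_ + _).
have le2 := toep_le ui (toep_le yi (x := vmonom A j) (b := j%:Z) _).
rewrite -embE le2 ?emb_monom; [by []| |by lia].
exact: lle_monom.
Qed.

(** If [v - 1] is divisible by a high power of [t], it is divisible by
    [t^n k] and [csym_mod_k] applies. *)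
Lemma csym_cont k : isK k -> exists M : nat, forall v, isU v ->
  lge M%:Z (v - 1) -> csym v k = 1.
Proof.
move=> kK; have [n kn] := lge_bound k; have [n' kn'] := lge_bound k^-1.
case: (kK) => _ _ _ kU.
exists (n + n').+1 => v vU vM.
have v0 : v 0 = 1.
  have := vM 0; rewrite lcoefD lcoefN lcoef1 eqxx => /(_ isT) /eqP.
  by rewrite subr_eq0 => /eqP.
rewrite (@csym_mod_k n v k (k^-1 * (v - 1))) ?v0 ?invr1 ?expr1n //.
  apply: lgeW (lgeM kn' vM); lia.
by rewrite mulrA divrr // mul1r addrC subrK.
Qed.

(** * The symbol of two binomials *)

Lemma unit_1subnil (b : A) M : b ^+ M = 0 -> 1 - b \is a GRing.unit.
Proof.
move=> bM; apply/unitrPr; exists (\sum_(i < M) b ^+ i).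
by rewrite -opprB mulNr -subrX1 bM sub0r opprK.
Qed.

(** Euclid's algorithm on [(i, j)]: modulo [1 - a t^i] the series
    [1 - b t^-j] is [1 - a b t^(i - j)] when [i < j], and symmetrically modulo
    [1 - b t^-j] when [j < i]. Both sides of the formula are invariant under
    these two moves. For [i = j], the series [1 - a t^i] is congruent to the
    constant [1 - a b]. *)
Lemma csym_geom (i j : nat) (a b : A) M : (0 < i)%N -> (0 < j)%N -> b ^+ M = 0 ->
  csym (1 - lmonom a i) (1 - lmonom b (- j%:Z)) =
  (1 - a ^+ (j %/ gcdn i j) * b ^+ (i %/ gcdn i j)) ^+ gcdn i j.
Proof.
have [n] := ubnP (i + j); elim: n i j a b => // n IHn i j a b ijn i0 j0 bM.
have abM : (a * b) ^+ M = 0 by rewrite exprMn bM mulr0.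
have uU := isU_geom a i0; have kK := isK_geom j0 bM.
case: (ltngtP i j) => ij.
- have ji : (0 < j - i)%N by rewrite subn_gt0.
  (* [k = 1 - b t^-j], reduced to [k' = 1 - a b t^(i - j)] modulo [u] *)
  have k'K := isK_geom ji abM; set k' := 1 - lmonom (a * b) _ in k'K.
  have k'U : k' \is a GRing.unit by case: k'K.
  set k := 1 - lmonom b _ in kK *; set u := 1 - lmonom a _ in uU *.
  have e : k = k' + u * lmonom (- b) (- j%:Z).
    have -> : u * lmonom (- b) (- j%:Z) =
        lmonom (a * b) (- (j - i)%N%:Z) - lmonom b (- j%:Z).
      rewrite /u mulrBl mul1r lmonomM mulrN !lmonomN opprK addrC.
      by congr (lmonom _ _ - _); lia.
    by rewrite addrA subrK.
  have e' : k / k' = 1 + u * (lmonom (- b) (- j%:Z) / k').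
    by rewrite e mulrDl divrr // mulrA.
  have KK := isKM kK (isKV k'K).
  have -> : k = k' * (k / k') by rewrite mulrC divrK.
  rewrite csymMr // [csym u (k / k')](@csym_mod_u i%:Z _ _ _ uU KK _ _ e') ?mulr1.
  + rewrite /k' IHn //; last by lia.
    have -> : gcdn i (j - i) = gcdn i j by rewrite -gcdnDl subnKC // ltnW.
    congr ((1 - _) ^+ _); rewrite exprMn mulrA -exprD.
    by rewrite -divnDr ?dvdn_gcdl // subnK // ltnW.
  + by apply: lleD; [apply: lleW (@lle1 A)|apply/lleN/lle_monom].
  + have := lleM (lle_monom (- b) (lexx (- j%:Z))) (let: And4 _ h _ _ := k'K in h).
    apply: lleW; lia.
- have ji : (0 < i - j)%N by rewrite subn_gt0.
  (* [u = 1 - a t^i], reduced to [u' = 1 - a b t^(i - j)] modulo [k] *)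
  have u'U := isU_geom (a * b) ji; set u' := 1 - lmonom (a * b) _ in u'U.
  have u'UU : u' \is a GRing.unit by case: u'U.
  set k := 1 - lmonom b _ in kK *; set u := 1 - lmonom a _ in uU *.
  have e : u = u' + k * lmonom (- a) i.
    have -> : k * lmonom (- a) i =
        lmonom (a * b) (i - j)%N%:Z - lmonom a i.
      rewrite /k mulrBl mul1r lmonomM mulrN !lmonomN opprK addrC.
      by rewrite [b * a]mulrC; congr (lmonom _ _ - _); lia.
    by rewrite addrA subrK.
  have e' : u / u' = 1 + k * (lmonom (- a) i / u').
    by rewrite e mulrDl divrr // mulrA.
  have UU := isUM uU (isUV u'U).
  have yj : lge j%:Z (lmonom (- a) i / u').
    have := lgeM (lge_monom (- a) (lexx i%:Z)) (pos_inv u'U); apply: lgeW; lia.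
  have kj : lge (- j%:Z) k.
    by apply: lgeD; [apply: lgeW (@lge1 A); lia|apply/lgeN/lge_monom].
  have c0 (c : A) (l : nat) : (0 < l)%N -> (1 - lmonom c l : L) 0 = 1.
    by move=> l0; rewrite lcoefD lcoefN lcoef1 lcoef_monom ifF ?subr0 //; lia.
  have -> : u = u' * (u / u') by rewrite mulrC divrK.
  rewrite csymMl // [csym (u / u') k](@csym_mod_k j _ _ _ UU kK kj yj e').
  rewrite posM0; [|by case: uU|exact: pos_inv].
  rewrite lcoef0_inv // /u /u' !c0 // !invr1 mulr1 invr1 expr1n mulr1.
  rewrite IHn //; last by lia.
  have -> : gcdn (i - j) j = gcdn i j.
    by rewrite gcdnC -gcdnDl subnKC ?(gcdnC j) // ltnW.
  congr ((1 - _) ^+ _); rewrite exprMn -mulrA -exprD.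
  by rewrite -divnDl ?dvdn_gcdr // subnKC // ltnW.
rewrite -{}ij in j0 kK *.
rewrite gcdnn divnn i0 !expr1.
have dU := unit_1subnil abM; set d := 1 - a * b in dU *.
set k := 1 - lmonom b _ in kK *; set u := 1 - lmonom a _ in uU *.
have UU := isUM (isU_monom (etrans (unitrV d) dU)) uU.
have e' : lmonom d^-1 0 * u = 1 + k * (lmonom (- (d^-1 * a)) i).
  have key : lmonom d^-1 0 = 1 + lmonom (b * (d^-1 * a)) 0.
    have {1}-> : d^-1 = 1 + b * (d^-1 * a).
      have := mulVr dU; move: (d^-1) => e; rewrite /d => ed.
      by transitivity (e * (1 - a * b) + e * (a * b)); [ring|rewrite ed; ring].
    apply: laurentP => m; rewrite lcoefD lcoef1 !lcoef_monom.
    by case: (m == 0); rewrite ?addr0.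
  rewrite /u /k mulrBr mulrBl mulr1 mul1r !lmonomM add0r addNr key.
  by rewrite mulrN !lmonomN opprK -addrA; congr (_ + _); rewrite addrC.
have kj : lge (- i%:Z) k.
  by apply: lgeD; [apply: lgeW (@lge1 A); lia|apply/lgeN/lge_monom].
have -> : u = lmonom d 0 * (lmonom d^-1 0 * u).
  by rewrite mulrA lmonomM divrr // mul1r.
rewrite csymMl //; last exact: isU_monom.
rewrite csym_const // mul1r (csym_mod_k UU kK kj _ e'); last exact: lge_monom.
rewrite posM0; [|exact: lge_monom|by case: uU].
rewrite /u lcoefD lcoefN lcoef1 !lcoef_monom eqxx ifF; last by lia.
by rewrite subr0 mulr1 invrK.
Qed.

(** * The Steinberg relation for the symbol *)
Section ShiftedToeplitz.
Variable w : nat.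
Let tau := lmonom 1 w%:Z : L.
Let tau' := lmonom 1 (- w%:Z) : L.

(** The operator which is the identity on polynomials of degree less than [w]
    and [T(h)], transported by [t^w], on [t^w A[[t]]]. *)
Definition toep_shift h : V -> V :=
  idfun \+ (toep tau \o toep (h - 1) \o toep tau').
HB.instance Definition _ h := GRing.Linear.copy (toep_shift h)
  (idfun \+ (toep tau \o toep (h - 1) \o toep tau')).

Lemma toep_shiftE h x : toep_shift h x = x + toep tau (toep (h - 1) (toep tau' x)).
Proof. by []. Qed.

Let tau_pos : pos tau. Proof. exact: lge_monom. Qed.
Let tau'_neg : neg tau'. Proof. by apply: lle_monom; lia. Qed.

Lemma toep_tauK x : toep tau' (toep tau x) = x.
Proof. by rewrite (toepMl _ _ tau'_neg) lmonomM mulr1 addNr toep1. Qed.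

Lemma toep_tauVK x : vge w x -> toep tau (toep tau' x) = x.
Proof.
move=> xw; rewrite toepM_pos ?lmonomM ?mulr1 ?subrr ?toep1 //.
have := lgeM (lge_monom (1 : A) (lexx (- w%:Z))) (emb_ge xw); apply: lgeW; lia.
Qed.

Lemma toep_shift_tau h x : toep_shift h (toep tau x) = toep tau (toep h x).
Proof. by rewrite toep_shiftE toep_tauK toepD toepN toep1 linearB /= addrC subrK. Qed.

Lemma toep_shiftK h x : isK h -> toep_shift h (toep_shift h^-1 x) = x.
Proof.
move=> [hn hn' h0 hU]; rewrite (toep_shiftE h).
have -> : toep tau' (toep_shift h^-1 x) = toep h^-1 (toep tau' x).
  by rewrite toep_shiftE linearD /= toep_tauK toepD toepN toep1 addrC subrK.
have hn1 : neg (h - 1) by apply: lleD => //; apply/lleN/lle1.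
rewrite (toepMl _ _ hn1) mulrBl mul1r divrr // toep_shiftE -addrA -linearD -toepD.
by rewrite /= addrA subrK subrr toep0 linear0 addr0.
Qed.

End ShiftedToeplitz.

(** Put [f = t^w u k], [v h = 1 - f] and [tau = T(t^w)]. The operator
    [G = T(h)^-1 (1 - tau T(k u)) T(v)^-1] satisfies
    [[u, h] G = (v/u) [v, k] (u/v)]: since [T(k u) tau = T(f) = 1 - T(v h)],
    passing [T(k u)] across [1 - tau T(k u)] produces [T(v h)]. So [det G] is
    [c(v, k) / c(u, h)]. On the other hand [1 - tau T(k u)] is the identity in
    degrees less than [w] and acts as [T(v h)] on [t^w A[[t]]]. Splitting [G] at
    the operator [toep_shift w h] gives an upper unitriangular factor [H] and a
    factor [R] which is the identity on [t^w A[[t]]], with the block of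
    [T(v)^-1] in lower degrees; its determinant is [v_0^-w]. *)
Lemma csym_steinberg (w : nat) u v k h : isU u -> isU v -> isK k -> isK h ->
  lmonom 1 w * u * k + v * h = 1 -> csym u h = v 0 ^+ w * csym v k.
Proof.
move=> uU vU kK hK fg.
have [N1 hN] := lge_bound h; have [N2 kN] := lge_bound k.
case: (uU) => _ _ uUU; case: (vU) => vp v0 vUU.
case: (kK) => kn kn' k0 kUU; case: (hK) => hn hn' h0 hUU.
pose tau := lmonom 1 w%:Z : L; have tau_pos : pos tau by exact: lge_monom.
have [M ME] : exists M : {linear V -> V},
    forall x, M x = x - toep tau (toep (k * u) x).
  by exists (idfun \- (toep tau \o toep (k * u)) : {linear V -> V}).
pose H : {linear V -> V} := toep h^-1 \o toep_shift w h.
pose R : {linear V -> V} := toep_shift w h^-1 \o M \o toep v^-1.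
have Mtau y : M (toep tau y) = toep tau (toep (v * h) y).
  rewrite ME (toepMr (k * u) _ tau_pos) -linearB /=; congr toep.
  rewrite -{1}[y]toep1 -toepN -toepD; congr (toep _ y).
  by apply/eqP; rewrite subr_eq -fg; apply/eqP; rewrite -/tau; ring.
have fR : fixes w R.
  move=> x xw; rewrite /R /=.
  rewrite -(toep_tauVK xw); set x' := toep _ x.
  rewrite (toepMr _ _ tau_pos) mulrC -(toepMr _ _ (pos_inv vU)) Mtau toep_shift_tau.
  rewrite (toepMl _ _ hn') mulrCA mulVr // mulr1; congr toep.
  exact: toepUVK.
have dR : opdet R = (v 0)^-1 ^+ w.
  rewrite (opdetE fR) -(lcoef0_inv vU) -det_toep; last exact: pos_inv.
  congr (\det _); apply/matrixP => i j; rewrite !mxE.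
  have tauw x : toep tau x i = 0.
    by apply: (@toep_ge _ w 0 w tau x) => //; [exact: lge_monom | rewrite addr0].
  by rewrite /R /= toep_shiftE vaddE tauw addr0 ME vsubE tauw subr0.
have fH : fixes (N1 + w) H.
  move=> x xN; rewrite /H /=.
  have xw : vge w x by apply: vgeW xN; lia.
  rewrite -(toep_tauVK xw) toep_shift_tau; set x' := toep _ x.
  have hx : pos (h * emb x').
    have x'N : vge N1 x'.
      by apply: (toep_ge (a := - w%:Z)) xN; [exact: lge_monom|lia].
    have := lgeM hN (emb_ge x'N); apply: lgeW; lia.
  rewrite (toepM_pos _ hx) mulrC -(toepMr _ _ tau_pos) toepKK //.
have dH : opdet H = 1.
  apply: (opdet_unip fH) => j m jm; rewrite /H /=.
  apply: toep_top => //; first exact: lcoef0_Kinv.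
  move=> l jl; rewrite toep_shiftE vaddE -[RHS]addr0; congr (_ + _).
  have h1 : lle (-1) (h - 1).
    move=> n n1; rewrite lcoefD lcoefN lcoef1; case: (eqVneq n 0) => [->|ne].
      by rewrite h0 subrr.
    by rewrite hn ?subrr //; lia.
  have le0 : lle j%:Z (emb (vmonom A j)) by rewrite emb_monom; exact: lle_monom.
  have le1 := toep_le (lle_monom 1 (lexx (- w%:Z))) le0.
  have le2 := toep_le (lle_monom 1 (lexx w%:Z)) (toep_le h1 le1).
  by rewrite -embE le2 //; lia.
have fX := fixesW (leq_addr w N1) (comm_fixes uU hK hN).
have gU := isUM vU (isUV uU); have hU := isUM uU (isUV vU).
have gV : (v / u)^-1 = u / v by rewrite invrM ?unitrV // invrK mulrC.
(* conjugate [[v, k]] so that it can be compared with [[u, h]] *)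
have [] := @opdet_conj _ N2 N2 (comm v k) (toep (v / u)) (toep (u / v)) _ _ (comm_fixes vU kK kN).
- by move=> x; rewrite /= -gV; exact: toepUK.
- by move=> x; rewrite /= -gV; exact: toepUVK.
- by move=> x xN; apply: (toep_ge (a := 0)) xN; [case: hU|lia].
move=> _ dY.
have fHR : fixes (N1 + w) (H \o R).
  by apply: fixes_comp fH _; apply: fixesW fR; lia.
have e : comm u h \o (H \o R) = toep (v / u) \o comm v k \o toep (u / v).
  apply: funext => x; rewrite /H /R /= !commE toep_shiftK //.
  rewrite toepKVK // -(toepMr u _ (pos_inv vU)) (toepMr _ _ (pos_inv vU)).
  rewrite mulrAC divrr // mul1r; congr toep; move: (toep v^-1 x) => y.
  rewrite -[LHS](toepKK _ kK); congr toep.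
  rewrite (toepMl _ _ kn) mulrC -(toepMl _ _ hn') (toepMl _ _ kn) ME linearB /=.
  rewrite (toepMl _ _ kn); set z := toep (k * u) y.
  rewrite (toepMr _ z tau_pos) -{1}[z]toep1 -toepN -toepD.
  have -> : 1 - k * u * tau = h * v.
    by apply/eqP; rewrite subr_eq -fg; apply/eqP; rewrite -/tau; ring.
  by rewrite -(toepMl _ _ hn) toepKK.
have f1 := opdetM fX fHR; have f2 := opdetM fH (fixesW (leq_addl N1 w) fR).
move: f1; rewrite e dY f2 dH dR mul1r -/(csym u h) -/(csym v k) => ->.
by rewrite mulrCA -exprMn divrr // expr1n mulr1.
Qed.

End Symbol.

(** * Powers of a finitely generated ideal *)
Section IdealPowers.
Variable A : comUnitRingType.

(** [ipow S s] is the [s]-th power of the ideal generated by [S]. Since a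
    Laurent series has finitely many coefficients of negative exponent, such
    ideals suffice for the factorization below, and nilpotency of their
    generators is enough to make them nilpotent. *)
Inductive ipow (S : seq A) : nat -> A -> Prop :=
| ipow_all x : ipow S 0 x
| ipow_gen s c x : c \in S -> ipow S s x -> ipow S s.+1 (c * x)
| ipow_zero s : ipow S s 0
| ipow_add s x y : ipow S s x -> ipow S s y -> ipow S s (x + y).

Variable S : seq A.
Local Notation I := (ipow S).

Lemma ipowM s t x y : I s x -> I t y -> I (s + t) (x * y).
Proof.
move=> Is It; elim: {s x} Is => [x|s c x cS _ IH|s|s x x' _ IH _ IH'].
- rewrite add0n; elim: It => [z|r c z cS _ IH|r|r z z' _ IH _ IH'].
  + exact: ipow_all.
  + by rewrite mulrCA; apply: ipow_gen.
  + by rewrite mulr0; apply: ipow_zero.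
  + by rewrite mulrDr; apply: ipow_add.
- by rewrite addSn -mulrA; apply: ipow_gen.
- by rewrite mul0r; apply: ipow_zero.
- by rewrite mulrDl; apply: ipow_add.
Qed.

Lemma ipowMl s x y : I s y -> I s (x * y).
Proof. by move=> Is; rewrite -[s]add0n; apply: ipowM => //; exact: ipow_all. Qed.

Lemma ipowN s x : I s x -> I s (- x).
Proof. by move=> Is; rewrite -mulN1r; apply: ipowMl. Qed.

Lemma ipowS s x : I s.+1 x -> I s x.
Proof.
move: {-1}(s.+1) (erefl s.+1) => r e Ir; elim: Ir s e => //.
- by move=> {}s c y cS Is _ _ [->]; exact: ipowMl.
- by move=> r' s _; exact: ipow_zero.
- by move=> r' y y' _ IH _ IH' s e; apply: ipow_add; [exact: IH|exact: IH'].
Qed.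

Lemma ipowW s t x : (t <= s)%N -> I s x -> I t x.
Proof.
move=> ts; rewrite -(subnK ts); elim: (s - t)%N => // d IHd.
by rewrite addSn => /ipowS.
Qed.

Lemma ipow1 x : x \in S -> I 1 x.
Proof. by move=> xS; rewrite -[x]mulr1; apply: ipow_gen => //; exact: ipow_all. Qed.

Lemma ipow_ideal (J : set A) x : is_ideal J -> (forall c, c \in S -> J c) ->
  I 1 x -> J x.
Proof.
move=> [J0 JD JM] SJ; move: {-1}1%N (erefl 1%N) => r e Ir.
elim: Ir e => //.
  by move=> s c y cS _ _ _; rewrite mulrC; apply: JM; exact: SJ.
by move=> s y y' _ IH _ IH' e; apply: JD; [exact: IH|exact: IH'].
Qed.

End IdealPowers.

(** A product of [s + t] generators contains [c] at least [s] times, or at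
    least [t] generators other than [c]. *)
Lemma ipow_split (A : comUnitRingType) c (S : seq A) s t x :
  ipow (c :: S) (s + t) x -> exists a y, x = c ^+ s * a + y /\ ipow S t y.
Proof.
move: {-1}(s + t)%N (erefl (s + t)%N) => r e Ir; elim: Ir s t e => {r x}.
- move=> x s t /eqP; rewrite addn_eq0 => /andP[/eqP-> /eqP->].
  by exists 0, x; rewrite mulr0 add0r; split=> //; exact: ipow_all.
- move=> r d x; rewrite inE => /orP[/eqP ->|dS] Ir IH [|s] t.
  + move=> _; exists (c * x), 0; rewrite expr0 mul1r addr0; split=> //.
    exact: ipow_zero.
  + rewrite addSn => -[/IH [a [y [-> Iy]]]]; exists a, (c * y).
    by rewrite exprS -mulrA -mulrDr; split=> //; exact: ipowMl.
  + case: t => [|t]; first by exists 0, (d * x); rewrite mulr0 add0r; split=> //; exact: ipow_all.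
    rewrite addnS => -[/IH [a [y [-> Iy]]]]; exists (d * a), (d * y).
    by rewrite mulrDr mulrCA; split=> //; exact: ipow_gen.
  + case: t => [|t]; first by exists 0, (d * x); rewrite mulr0 add0r; split=> //; exact: ipow_all.
    rewrite addnS => -[/IH [a [y [-> Iy]]]]; exists (d * a), (d * y).
    by rewrite mulrDr mulrCA; split=> //; exact: ipow_gen.
- by move=> r s t _; exists 0, 0; rewrite mulr0 addr0; split=> //; exact: ipow_zero.
- move=> r x x' _ IH _ IH' s t e.
  have [a [y [-> Iy]]] := IH _ _ e; have [a' [y' [-> Iy']]] := IH' _ _ e.
  by exists (a + a'), (y + y'); split; [ring|exact: ipow_add].
Qed.

Lemma ipow_nil (A : comUnitRingType) (S : seq A) :
  (forall c, c \in S -> exists n, c ^+ n = 0) ->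
  exists M, forall x, ipow S M x -> x = 0.
Proof.
elim: S => [|c S IH] Snil.
  exists 1%N => x; move: {-1}1%N (erefl 1%N) => r e Ir; elim: Ir e => //.
  by move=> s y y' _ IH _ IH' e; rewrite IH ?IH' ?addr0.
have [d dS|M HM] := IH; first by apply: Snil; rewrite inE dS orbT.
have [n cn] := Snil c (mem_head _ _).
exists (n + M)%N => x /ipow_split [a [y [-> /HM ->]]].
by rewrite cn mul0r addr0.
Qed.

(** * Factorization of invertible series *)
Section LaurentIdeals.
Variables (A : comUnitRingType) (S : seq A) (M : nat).
Hypothesis SM : forall x, ipow S M x -> x = 0.
Notation L := (laurent A).
Implicit Types f g u k : L.

Definition lI s f := forall n, ipow S s (f n).

Lemma lIM s t f g : lI s f -> lI t g -> lI (s + t) (f * g).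
Proof.
move=> fI gI n; have [a fa] := lge_ex f; have [b gb] := lge_ex g.
rewrite (lcoefM_sum (M := (absz (n - (a + b))%R).+1) fa gb); last by lia.
by elim/big_rec: _ => [|i x _ Ix]; [exact: ipow_zero|apply: ipow_add => //; exact: ipowM].
Qed.

Lemma lI0 f : lI 0 f.
Proof. by move=> n; exact: ipow_all. Qed.

Lemma lIMr s f g : lI s f -> lI s (f * g).
Proof. by move=> fI; rewrite -[s]addn0; apply: lIM => //; exact: lI0. Qed.

Lemma lID s f g : lI s f -> lI s g -> lI s (f + g).
Proof. by move=> fI gI n; exact: ipow_add. Qed.

Lemma lIN s f : lI s f -> lI s (- f).
Proof. by move=> fI n; exact: ipowN. Qed.

Lemma lIW s t f : (t <= s)%N -> lI s f -> lI t f.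
Proof. by move=> ts fI n; exact: ipowW (fI n). Qed.

Lemma lI_eq0 f : lI M f -> f = 0.
Proof. by move=> fI; apply: laurentP => n; rewrite (SM (fI n)) /= if_same. Qed.

Lemma lI_nil f : lI 1 f -> f ^+ M = 0.
Proof.
move=> fI; apply: lI_eq0; elim: M => [|n IHn]; first exact: lI0.
by rewrite exprS -add1n; apply: lIM.
Qed.

Lemma ipow1_nil x : ipow S 1 x -> x ^+ M = 0.
Proof.
move=> Ix; apply: SM; elim: M => [|n IHn]; first exact: ipow_all.
by rewrite exprS -add1n; apply: ipowM.
Qed.

#[local] Obligation Tactic := idtac.
Program Definition pos_part f : L :=
  Laurent (lcoef := fun n => if 0 <= n then f n else 0) _.
Next Obligation. by move=> f; exists 0 => n n0; rewrite leNgt n0. Qed.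

Definition neg_part f : L := f - pos_part f.

Lemma pos_part_pos f : pos (pos_part f).
Proof. by move=> n n0; rewrite /= leNgt n0. Qed.

Lemma neg_partE f n : neg_part f n = if 0 <= n then 0 else f n.
Proof. by rewrite lcoefD lcoefN /=; case: ifP; rewrite ?subrr ?subr0. Qed.

Lemma neg_part_neg f : lle (-1) (neg_part f).
Proof. by move=> n n0; rewrite neg_partE ifT //; lia. Qed.

Lemma partD f : f = pos_part f + neg_part f.
Proof. by rewrite addrC subrK. Qed.

Lemma lI_pos_part s f : lI s f -> lI s (pos_part f).
Proof. by move=> fI n /=; case: ifP => // _; exact: ipow_zero. Qed.

Lemma lI_neg_part s f : lI s f -> lI s (neg_part f).
Proof. by move=> fI; apply: lID => //; apply/lIN/lI_pos_part. Qed.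

Lemma isK_1D f : lle (-1) f -> lI 1 f -> isK (1 + f).
Proof.
move=> fn fI; rewrite -[f]opprK; apply: (@isK_nil _ _ M); first exact: lleN.
by apply: lI_nil; exact: lIN.
Qed.

Lemma isU_1D f : pos f -> lI 1 f -> isU (1 + f).
Proof.
move=> fp fI; split.
- by apply: lgeD => //; exact: lge1.
- rewrite lcoefD lcoef1 eqxx -[f 0]opprK; apply: (@unit_1subnil _ _ M).
  by apply: ipow1_nil; exact: ipowN.
- rewrite -[f]opprK; apply: (@unit_1subnil _ _ M).
  by apply: lI_nil; exact: lIN.
Qed.

(** If [f = 1 + p + nu], with [p] and [nu] the parts of nonnegative and of
    negative exponents, then dividing [f] by [(1 + p) (1 + nu)] leaves
    [1 - p nu / ((1 + p) (1 + nu))], which is closer to 1; nilpotency ends the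
    process. *)
Lemma factor_near1 s f : (0 < s)%N -> lI s (f - 1) ->
  exists u k, [/\ isU u, isK k, lI 1 (k - 1) & f = u * k].
Proof.
have [n] := ubnP (M - s); elim: n s f => // n IHn s f lts s0 fI.
have [le|lt] := leqP M s.
  exists 1, 1; split; [exact: isU1|exact: isK1| |].
    by rewrite subrr => m; rewrite /= if_same; exact: ipow_zero.
  by rewrite mulr1; apply/eqP; rewrite -subr_eq0; apply/eqP/lI_eq0/(lIW le).
pose p := pos_part (f - 1); pose nu := neg_part (f - 1).
have pI : lI s p := lI_pos_part fI; have nI : lI s nu := lI_neg_part fI.
have fE : f = 1 + p + nu by rewrite -addrA -partD addrC subrK.
have U1 : isU (1 + p) by apply: isU_1D; [exact: pos_part_pos|exact: lIW pI].
have K1 : isK (1 + nu) by apply: isK_1D; [exact: neg_part_neg|exact: lIW nI].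
have U1U : 1 + p \is a GRing.unit by case: U1.
have K1U : 1 + nu \is a GRing.unit by case: K1.
have U2 : (1 + p) * (1 + nu) \is a GRing.unit by rewrite unitrM U1U.
have f'I : lI s.+1 (f / ((1 + p) * (1 + nu)) - 1).
  rewrite (_ : _ - 1 = (f - (1 + p) * (1 + nu)) / ((1 + p) * (1 + nu))); last first.
    by rewrite mulrBl divrr.
  have -> : f - (1 + p) * (1 + nu) = - (p * nu) by rewrite fE; ring.
  apply: lIMr; apply: lIN; apply: (@lIW (s + s)); first by lia.
  exact: lIM.
have [|//|u [k [uU kK kI e]]] := IHn s.+1 _ _ _ f'I; first by lia.
exists ((1 + p) * u), ((1 + nu) * k); split.
- exact: isUM.
- exact: isKM.
- have -> : (1 + nu) * k - 1 = nu * k + (k - 1) by ring.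
  by apply: lID => //; apply: lIMr; apply: lIW nI.
- by rewrite mulrACA -e mulrC divrK.
Qed.

(** The binomial factors of [k] are extracted one exponent at a time. The
    product is finite by weighted homogeneity: if the exponents of [k] are at
    least [-n], the coefficient of [t^-j] in every remainder lies in the power
    of the ideal of exponent [j / n] rounded up, and this power vanishes for
    large [j]. *)
Section NegativeProduct.
Variables (k : L) (N : nat).
Hypotheses (kK : isK k) (kI : lI 1 (k - 1)) (kN : lge (- N%:Z) k).

Fixpoint nrem i : L :=
  if i is i'.+1 then
    nrem i' / (1 + lmonom (nrem i' (- i%:Z)) (- i%:Z))
  else k.

Lemma nremS i :
  nrem i.+1 = nrem i / (1 + lmonom (nrem i (- i.+1%:Z)) (- i.+1%:Z)).
Proof. by []. Qed.

(** The third clause is the weighted bound, with [s < j / N.+1 + 1] standing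
    for the rounding up. *)
Lemma nremP i : [/\ isK (nrem i), forall j, (0 < j <= i)%N -> nrem i (- j%:Z) = 0 &
  forall j s, (s * N.+1 < j + N.+1)%N -> ipow S s (nrem i (- j%:Z))].
Proof.
elim: i => [|i [gK g0 gF]].
  split=> //=; first by move=> j; lia.
  move=> j [|[|s]] ltj; first exact: ipow_all.
    have j0 : (0 < j)%N by lia.
    have := kI (- j%:Z); rewrite lcoefD lcoefN lcoef1.
    have -> : (- j%:Z == 0) = false by lia.
    by rewrite subr0.
  rewrite kN; [exact: ipow_zero|nia].
rewrite nremS; set g := nrem i in gK g0 gF *; set c := g _.
have cF s : (s * N.+1 < i.+1 + N.+1)%N -> ipow S s c by exact: gF.
have c1 : ipow S 1 c by apply: cF; lia.
have qK : isK (1 + lmonom c (- i.+1%:Z)).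
  apply: isK_1D; first by apply: lle_monom; lia.
  by move=> n /=; case: ifP => // _; exact: ipow_zero.
set q := 1 + _ in qK *; have g'K := isKM gK (isKV qK).
set g' := g / q in g'K *.
have qU : q \is a GRing.unit by case: qK.
have e j : g' j = g j - c * g' (j + i.+1%:Z).
  have -> : g j = (g' * q) j by rewrite divrK.
  rewrite mulrDr mulr1 lcoefD [g' * _]mulrC lcoef_monomM opprK addrK //.
have [gn' _ g'0 _] := g'K.
have gn : neg g by case: gK.
split=> //.
- move=> j /andP[j0 ji]; rewrite e; have [le|lt] := leqP j i.
    by rewrite g0 ?j0 // gn' ?mulr0 ?subr0 //; lia.
  have -> : j = i.+1 by lia.
  by rewrite addNr g'0 mulr1 subrr.
- elim/ltn_ind => j IHj s sj; rewrite e; apply: ipow_add; first exact: gF.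
  apply: ipowN; have [lt|le] := ltnP j i.+1.
    rewrite gn' ?mulr0; [exact: ipow_zero|lia].
  have -> : - j%:Z + i.+1%:Z = - (j - i.+1)%N%:Z by lia.
  (* [s1] is [i.+1 / N.+1] rounded up, the largest exponent known for [c] *)
  pose s1 := ((i + N.+1) %/ N.+1)%N.
  have hs1 : (i + N.+1 < s1 * N.+1 + N.+1 <= i.+1 + N.+1 + N)%N.
    by rewrite /s1; have := divn_eq (i + N.+1) N.+1; have := ltn_pmod (i + N.+1) (ltn0Sn N); lia.
  have cs1 : ipow S s1 c by apply: cF; lia.
  have [le1|lt1] := leqP s s1.
    by rewrite mulrC; apply: ipowMl; exact: ipowW cs1.
  rewrite -(subnKC (ltnW lt1)); apply: ipowM => //; apply: IHj; first by lia.
  by rewrite mulnBl; lia.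
Qed.

Lemma nrem_final i : (N.+1 * M <= i)%N -> nrem i = 1.
Proof.
move=> le; have [gK g0 gF] := nremP i; have [gn _ g1 _] := gK.
apply: laurentP => n; rewrite lcoef1.
case: (ltgtP n 0) => [n0|n0|->] //; last by rewrite gn.
have -> : n = - (absz n)%:Z by lia.
have [le'|lt'] := leqP (absz n) i; first by rewrite g0 //; lia.
by apply: SM; apply: gF; lia.
Qed.

Definition ncoef i : A := - nrem i.-1 (- i%:Z).

Lemma ncoefI i : (0 < i)%N -> ipow S 1 (ncoef i).
Proof.
case: i => // i _; apply: ipowN => /=; have [_ _ gF] := nremP i; apply: gF; lia.
Qed.

Lemma ncoef0 i : (N.+1 * M < i)%N -> ncoef i = 0.
Proof.
case: i => // i le; rewrite /ncoef nrem_final // lcoef1.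
rewrite (_ : (- i.+1%:Z == 0) = false) ?oppr0 //; lia.
Qed.

Lemma nrem_prod n : k = \prod_(1 <= i < n.+1) (1 - lmonom (ncoef i) (- i%:Z)) * nrem n.
Proof.
elim: n => [|n IHn]; first by rewrite big_nil mul1r.
rewrite big_nat_recr // -mulrA {1}IHn; congr (_ * _).
rewrite nremS /ncoef lmonomN opprK mulrC divrK //.
have [gK _ gF] := nremP n.
have : isK (1 + lmonom (nrem n (- n.+1%:Z)) (- n.+1%:Z)); last by case.
apply: isK_1D; first by apply: lle_monom; lia.
by move=> m /=; case: ifP => // _; [apply: gF; lia|exact: ipow_zero].
Qed.

End NegativeProduct.
End LaurentIdeals.

(** The corresponding extraction for power series, whose infinite product
    converges t-adically. *)
Section PositiveProduct.
Variables (A : comUnitRingType).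
Notation L := (laurent A).
Implicit Types u : L.

Definition ppart (a : nat -> A) (m n : nat) : L := \prod_(m <= i < n) (1 - lmonom (a i) i).

Lemma ppart_ge a m n : lge m%:Z (ppart a m n - 1) /\ isU (ppart a m.+1 n).
Proof.
split; last first.
  rewrite /ppart big_seq; elim/big_rec: _ => [|i x]; first exact: isU1.
  by rewrite mem_index_iota => /andP[i0 _]; apply: isUM; apply: isU_geom; lia.
rewrite /ppart big_seq; elim/big_rec: _ => [|i x].
  by rewrite subrr => j _; rewrite /= if_same.
rewrite mem_index_iota => /andP[mi _] xm.
have -> : (1 - lmonom (a i) i) * x - 1 = (x - 1) + - (lmonom (a i) i * (x - 1)) - lmonom (a i) i by ring.
apply: lgeD; last by apply/lgeN/lge_monom; lia.
apply: lgeD => //; apply: lgeN.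
have := lgeM (lge_monom (a i) (lexx i%:Z)) xm; apply: lgeW; lia.
Qed.

Variable u : L.
Hypotheses (uU : isU u) (u1 : u 0 = 1).

Fixpoint prem i : L :=
  if i is i'.+1 then prem i' / (1 + lmonom (prem i' i) i) else u.
Lemma premS i : prem i.+1 = prem i / (1 + lmonom (prem i i.+1) i.+1).
Proof. by []. Qed.

Definition pcoef i : A := - prem i.-1 i.

Lemma premP i : [/\ isU (prem i), prem i 0 = 1 &
  forall j : nat, (0 < j <= i)%N -> prem i j = 0].
Proof.
elim: i => [|i [gU g1 g0]]; first by split=> // j; lia.
rewrite premS; set g := prem i in gU g1 g0 *; set c := g _.
have qU : isU (1 + lmonom c i.+1).
  by rewrite -[c]opprK lmonomN; apply: isU_geom.
set q := 1 + _ in qU *; have g'U := isUM gU (isUV qU).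
set g' := g / q in g'U *.
have qU' : q \is a GRing.unit by case: qU.
have e j : g' j = g j - c * g' (j - i.+1%:Z).
  have -> : g j = (g' * q) j by rewrite divrK.
  by rewrite mulrDr mulr1 lcoefD [g' * _]mulrC lcoef_monomM addrK.
have [gp' _ _] := g'U.
have g'1 : g' 0 = 1 by rewrite e gp' ?mulr0 ?subr0.
split=> // j /andP[j0 ji]; rewrite e; have [le|lt] := leqP j i.
  by rewrite g0 ?j0 // gp' ?mulr0 ?subr0 //; lia.
have -> : j = i.+1 by lia.
by rewrite subrr g'1 mulr1 subrr.
Qed.

Lemma prem_prod n : u = ppart pcoef 1 n.+1 * prem n.
Proof.
elim: n => [|n IHn]; first by rewrite /ppart big_nil mul1r.
rewrite /ppart big_nat_recr // -mulrA {1}IHn; congr (_ * _).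
rewrite premS /pcoef lmonomN opprK mulrC divrK //.
have : isU (1 + lmonom (prem n n.+1) n.+1); last by case.
by rewrite -[prem n _]opprK lmonomN; apply: isU_geom.
Qed.

Lemma prem_limit : tadic_limit (fun n => ppart pcoef 1 n.+1) u.
Proof.
move=> d; exists (absz d) => n dn m md.
rewrite [in RHS](prem_prod n); have [gU g1 g0] := premP n.
have gp : pos (prem n) by case: gU.
have ge : lge n.+1%:Z (prem n - 1).
  move=> j jn; rewrite lcoefD lcoefN lcoef1.
  case: (ltgtP j 0) => j0; first by rewrite gp ?subr0.
    have -> : j = (absz j)%:Z by lia.
    by rewrite g0 ?subr0 //; lia.
  by rewrite j0 g1 subrr.
have [_ [pp _ _]] := ppart_ge pcoef 0 n.+1.
have := lgeM pp ge => /(_ m); rewrite add0r mulrBr mulr1 lcoefD lcoefN => H.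
by apply/eqP; rewrite eq_sym -subr_eq0; apply/eqP; apply: H; lia.
Qed.

End PositiveProduct.

(** * The double product as a value of the symbol *)
Section ProductFormula.
Variable A : comUnitRingType.
Notation L := (laurent A).
Implicit Types (x y : nat -> A).

Definition ccf x y (i j : nat) : A :=
  (1 - x i ^+ (j %/ gcdn i j) * y j ^+ (i %/ gcdn i j)) ^+ gcdn i j.

Definition ccf_trivial x y B := forall i j, (0 < i)%N -> (0 < j)%N ->
  (B < i)%N || (B < j)%N -> ccf x y i j = 1.

Lemma cc_prodE x y B : ccf_trivial x y B ->
  cc_prod x y = \prod_(1 <= i < B.+1) \prod_(1 <= j < B.+1) ccf x y i j.
Proof.
move=> triv.
have inner i : (0 < i)%N -> \big[*%R/1]_(j \in [set j | (0 < j)%N]%classic) ccf x y i j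
    = \prod_(1 <= j < B.+1) ccf x y i j.
  move=> i0; rewrite (fsbigE (index_iota 1 B.+1)) ?iota_uniq //.
  - rewrite big_seq_cond [RHS]big_seq; apply: eq_bigl => j.
    rewrite andb_idr // mem_index_iota => /andP[j0 _]; exact: mem_set.
  - by move=> j /=; rewrite mem_index_iota => /andP[].
  - move=> j /= j0; rewrite mem_index_iota j0 ltnS /= -ltnNge => Bj.
    by apply: triv => //; rewrite Bj orbT.
rewrite /cc_prod (fsbigE (index_iota 1 B.+1)) ?iota_uniq //.
- rewrite big_seq_cond [RHS]big_seq; apply: eq_big => [i|i].
    rewrite andb_idr // mem_index_iota => /andP[i0 _]; exact: mem_set.
  by rewrite mem_index_iota => /andP[/andP[i0 _] _]; exact: inner.
- by move=> i /=; rewrite mem_index_iota => /andP[].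
- move=> i /= i0; rewrite mem_index_iota i0 ltnS /= -ltnNge => Bi.
  rewrite inner // big_seq big1 // => j.
  by rewrite mem_index_iota => /andP[j0 _]; apply: triv => //; rewrite Bi.
Qed.

Lemma ccfC x y i j : ccf x y i j = ccf y x j i.
Proof. by rewrite /ccf gcdnC mulrC. Qed.

(** For [j <= N] the exponent of [y_j] is at least [i / j], so it is at
    least [E] once [i >= E * N]. *)
Lemma ccf_triv_fin x y N E : (forall j, (0 < j)%N -> y j ^+ E = 0) ->
  (forall j, (N < j)%N -> y j = 0) -> ccf_trivial x y (N + E * N).
Proof.
move=> yE yN i j i0 j0 B.
suff : y j ^+ (i %/ gcdn i j) = 0 by rewrite /ccf => ->; rewrite mulr0 subr0 expr1n.
have g0 : (0 < gcdn i j)%N by rewrite gcdn_gt0 i0.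
have [Nj|jN] := ltnP N j.
  rewrite yN // expr0n; case: eqP => // /eqP.
  by rewrite -leqn0 leqNgt divn_gt0 // dvdn_leq // dvdn_gcdl.
have le : (E <= i %/ gcdn i j)%N.
  rewrite leq_divRL //; apply: (@leq_trans (E * N)); last by move: B; lia.
  by rewrite leq_mul2l; apply/orP; right; apply: leq_trans jN; rewrite dvdn_leq // dvdn_gcdr.
by rewrite -(subnK le) exprD yE // mulr0.
Qed.

Lemma ccf_trivW x y B B' : (B <= B')%N -> ccf_trivial x y B -> ccf_trivial x y B'.
Proof. by move=> le triv i j i0 j0 h; apply: triv => //; lia. Qed.

Lemma cc_prodC x y N E : (forall j, (0 < j)%N -> y j ^+ E = 0) ->
  (forall j, (N < j)%N -> y j = 0) -> cc_prod x y = cc_prod y x.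
Proof.
move=> yE yN; have triv := ccf_triv_fin x yE yN.
rewrite (cc_prodE triv) (@cc_prodE y x (N + E * N)); last first.
  by move=> i j i0 j0 h; rewrite ccfC triv // orbC.
rewrite exchange_big /=; apply: eq_bigr => j _; apply: eq_bigr => i _.
exact: ccfC.
Qed.

Section ValueOnProducts.
Variables (x y : nat -> A) (p : L) (N E : nat).
Hypotheses (yE : forall j, (0 < j)%N -> y j ^+ E = 0)
  (yN : forall j, (N < j)%N -> y j = 0)
  (p_lim : tadic_limit (fun n => ppart x 1 n.+1) p) (pU : p \is a GRing.unit).
Let k : L := \prod_(1 <= j < N.+1) (1 - lmonom (y j) (- j%:Z)).

Lemma isK_prod n : isK (\prod_(1 <= j < n) (1 - lmonom (y j) (- j%:Z)) : L).
Proof.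
rewrite big_seq; elim/big_rec: _ => [|j q]; first exact: isK1.
by rewrite mem_index_iota => /andP[j0 _]; apply: isKM; apply: isK_geom (yE _).
Qed.

Lemma limit_isU : isU p /\ p 0 = 1.
Proof.
have ge1 n : lge 1 (ppart x 1 n - 1) by case: (ppart_ge x 1 n).
have p0 : p 0 = 1.
  have [K /(_ K (leqnn K) 0 isT) <-] := p_lim 1.
  by have := ge1 K.+1 0 isT; rewrite lcoefD lcoefN lcoef1 eqxx => /eqP; rewrite subr_eq0 => /eqP.
split=> //; split; rewrite ?p0 ?unitr1 // => n n0.
have [K /(_ K (leqnn K) n n0) <-] := p_lim 0.
by have [_ [+ _ _]] := ppart_ge x 0 K.+1; apply.
Qed.

Lemma limit_tail B : lge B.+1%:Z (p / ppart x 1 B.+1 - 1).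
Proof.
have [_ qU] := ppart_ge x 0 B.+1; set q := ppart x 1 B.+1 in qU *.
have qU' : q \is a GRing.unit by case: qU.
have -> : p / q - 1 = q^-1 * (p - q) by rewrite mulrBr mulVr // mulrC.
rewrite -[B.+1%:Z]add0r; apply: lgeM; first exact: pos_inv.
move=> m mB; have [K /(_ (K + B)%N (leq_addr _ _) m mB) e] := p_lim B.+1%:Z.
rewrite lcoefD lcoefN -e.
have -> : ppart x 1 (K + B).+1 = q * ppart x B.+1 (K + B).+1.
  by rewrite /q /ppart -big_cat_nat //=; lia.
have [h _] := ppart_ge x B.+1 (K + B).+1; have [qp _ _] := qU.
have := lgeM qp h => /(_ m); rewrite add0r mulrBr mulr1 lcoefD lcoefN; exact.
Qed.

Lemma csym_product : csym p k = cc_prod x y.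
Proof.
have kK : isK k := isK_prod N.+1.
have [M0 cM] := csym_cont kK.
pose B := (M0 + (N + E * N))%N.
have triv : ccf_trivial x y B by apply: ccf_trivW (ccf_triv_fin x yE yN); rewrite /B; lia.
rewrite (cc_prodE triv).
have [_ qU] := ppart_ge x 0 B.+1; have [pU' _] := limit_isU.
have vU := isUM pU' (isUV qU).
have -> : p = ppart x 1 B.+1 * (p / ppart x 1 B.+1).
  by rewrite mulrC divrK //; case: qU.
rewrite csymMl // [X in _ * X]cM //; last first.
  by apply: lgeW (@limit_tail B); rewrite /B; lia.
have -> : k = \prod_(1 <= j < B.+1) (1 - lmonom (y j) (- j%:Z)).
  rewrite (@big_cat_nat _ _ _ N.+1 1 B.+1) //=; last by rewrite /B; lia.
  rewrite [X in _ * X]big_seq [X in _ * X]big1 ?mulr1 // => j.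
  rewrite mem_index_iota => /andP[jN _].
  by rewrite yN // lmonom0 subr0.
rewrite mulr1 /ppart.
have left (n : nat) K : isK K -> csym (\prod_(1 <= i < n) (1 - lmonom (x i) i)) K
    = \prod_(1 <= i < n) csym (1 - lmonom (x i) i) K.
  move=> KK; elim: n => [|n IHn]; first by rewrite !big_geq ?csym1l.
  case: n => [|n] in IHn *; first by rewrite !big_geq ?csym1l.
  rewrite [X in csym X]big_nat_recr // [RHS]big_nat_recr //= csymMl ?IHn //; last exact: isU_geom.
  by have [_] := ppart_ge x 0 n.+1.
rewrite left; last exact: isK_prod.
rewrite [LHS]big_seq [RHS]big_seq; apply: eq_bigr => i.
rewrite mem_index_iota => /andP[i0 _].
have UU := isU_geom (x i) i0.
elim: (B.+1) => [|n IHn]; first by rewrite !big_geq ?csym1r.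
case: n => [|n] in IHn *; first by rewrite !big_geq ?csym1r.
rewrite [X in csym _ X]big_nat_recr // [RHS]big_nat_recr //= csymMr ?IHn //; [|exact: isK_prod|exact: isK_geom (yE _)].
by congr (_ * _); apply: csym_geom (yE _).
Qed.

End ValueOnProducts.
End ProductFormula.

(** * Decompositions over an artinian local ring *)
Section Decomposition.
Variable A : comUnitRingType.
Notation L := (laurent A).

Definition decomp (f : L) (w : int) (u k : L) :=
  [/\ isU u, isK k & f = lmonom 1 w * u * k].

(** The quotient [u' / u] has nonnegative exponents and [k / k'] nonpositive
    ones with constant term 1; if they agree up to a power of [t], that power
    is 1 and both are 1. *)
Lemma decomp_uniq f w u k w' u' k' : decomp f w u k -> decomp f w' u' k' ->
  [/\ w = w', u = u' & k = k'].
Proof.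
wlog le : w u k w' u' k' / w <= w'.
  move=> H d d'; have [/ltW le|le] := ltP w' w; last exact: H d d'.
  by have [-> -> ->] := H _ _ _ _ _ _ le d' d.
move=> [uU kK fE] [u'U k'K fE'].
have uUU : u \is a GRing.unit by case: uU.
have kUU : k \is a GRing.unit by case: kK.
have k'UU : k' \is a GRing.unit by case: k'K.
have qU := isUM u'U (isUV uU); have lK := isKM kK (isKV k'K).
set q := u' / u in qU; set l := k / k' in lK.
have e : lmonom 1 (w' - w) * q = l.
  have tU d := lmonom1_unit A d.
  apply: (mulrI (tU w)); rewrite mulrA lmonomM mulr1.
  have -> : w + (w' - w) = w' by lia.
  apply: (mulIr uUU); apply: (mulIr k'UU).
  rewrite /q mulrA divrK // -fE' fE -[in LHS](divrK k'UU k) -/l.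
  by ring.
have [qp q0 _] := qU; have [ln _ l0 _] := lK.
have ww : w = w'.
  apply/eqP; rewrite eq_le le /= leNgt; apply/negP => lt.
  have : l 0 = 0 by rewrite -e lcoef_monomM mul1r qp //; lia.
  by rewrite l0 => /eqP; rewrite oner_eq0.
subst w'; rewrite subrr lmonom1 mul1r in e.
have q1 : q = 1.
  apply: laurentP => n; rewrite lcoef1; case: (ltgtP n 0) => n0.
  - exact: qp.
  - by rewrite e ln.
  - by rewrite n0 e l0.
split=> //.
  by have := divrK uUU u'; rewrite -/q q1 mul1r.
by have := divrK k'UU k; rewrite -/l -e q1 mul1r.
Qed.

End Decomposition.

Section LocalArtinian.
Variable A : comUnitRingType.
Hypotheses (A_local : local_ring A) (A_artinian : artinian_ring A).
Notation L := (laurent A).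
Notation m := (@the_maximal_ideal A).

Let m_ideal : is_ideal m.
Proof. by case: (the_maximal_idealP A_local). Qed.
Let m0 : m 0. Proof. by case: m_ideal. Qed.
Let mD x y : m x -> m y -> m (x + y). Proof. by case: m_ideal => _ + _; apply. Qed.
Let mM x y : m y -> m (x * y). Proof. by case: m_ideal => _ _; apply. Qed.
Let m1 : ~ m 1.
Proof. by have [mi mT _] := the_maximal_idealP A_local; exact: ideal_neqT. Qed.

Lemma max_nonunit x : x \isn't a GRing.unit -> m x.
Proof.
move=> /nonunit_maximal [m' m'm m'x]; have [m2 [_ um]] := A_local.
by rewrite -(um _ (the_maximal_idealP A_local)) (um _ m'm).
Qed.

(** The chain of the ideals [x^n A] is stationary, so [x^n (1 - c x) = 0] for
    some [c], and [1 - c x] is a unit. *)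
Lemma max_nil x : m x -> exists n, x ^+ n = 0.
Proof.
move=> mx; pose I n : set A := [set y | exists c, y = c * x ^+ n]%classic.
have [||n /(_ n.+1 (leqnSn n)) e] := A_artinian (I := I).
- move=> n; split; first by exists 0; rewrite mul0r.
  + by move=> _ _ [a ->] [b ->]; exists (a + b); rewrite mulrDl.
  + by move=> a _ [b ->]; exists (a * b); rewrite mulrA.
- by move=> n _ [c ->]; exists (c * x); rewrite exprS mulrA.
have : I n.+1 (x ^+ n) by rewrite e; exists 1; rewrite mul1r.
move=> [c ec]; exists n.
have U : 1 - c * x \is a GRing.unit by apply: maximal_ideal_unitB => //; exact: mM.
apply: (mulrI U); rewrite mulr0 mulrBl mul1r -mulrA -exprS {1}ec subrr //.
Qed.

Lemma max_nil_unif (y : nat -> A) N : (forall j, (0 < j)%N -> m (y j)) ->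
  (forall j, (N < j)%N -> y j = 0) ->
  exists E, forall j, (0 < j)%N -> y j ^+ E = 0.
Proof.
move=> my yN.
suff [E HE] : exists E, forall j, (0 < j <= N)%N -> y j ^+ E = 0.
  exists E.+1 => j j0; have [jN|Nj] := leqP j N.
    by rewrite exprS HE ?mulr0 // j0.
  by rewrite yN // expr0n.
elim: N {yN} => [|N [E HE]]; first by exists 0%N => j; lia.
have [E' HE'] := max_nil (my N.+1 isT).
exists (E + E')%N => j /andP[j0 jN]; rewrite exprD; have [le|lt] := leqP j N.
  by rewrite HE ?mul0r // j0.
by have -> : j = N.+1 by [lia]; rewrite HE' mulr0.
Qed.

(** The valuation of the reduction of [f] modulo the maximal ideal. *)
Definition order (f : L) w := (forall n : int, n < w -> m (f n)) /\ ~ m (f w).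

Lemma order_uniq f w w' : order f w -> order f w' -> w = w'.
Proof. by move=> [l n] [l' n']; case: (ltgtP w w') => // [/l'|/l]. Qed.

Lemma order_ex f : f \is a GRing.unit -> exists w, order f w.
Proof.
move=> fU; have [a fa] := lge_ex f; have [b gb] := lge_ex f^-1.
have [n nm] : exists n : nat, ~ m (f (a + n%:Z)).
  apply: contrapT => /forallNP H; apply: m1.
  have -> : 1 = (f * f^-1) 0 by rewrite divrr // lcoef1.
  rewrite (lcoefM_sum (M := (absz (a + b)%R).+1) fa gb); last by lia.
  elim/big_rec: _ => // i x _ mx; apply: mD => //.
  by rewrite mulrC; apply: mM; have := H i => /contrapT.
have ex : exists n : nat, ~~ `[< m (f (a + n%:Z)) >] by exists n; apply/asboolPn.
case: (ex_minnP ex) => i /asboolPn im imin; exists (a + i%:Z); split=> // j ja.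
have [lt|le] := ltP j a; first by rewrite fa.
apply: contrapT => nmj; have := imin (absz (j - a)).
have -> : a + (absz (j - a))%:Z = j by lia.
by move=> /(_ (introT (asboolPn _) nmj)); lia.
Qed.

(** The coefficients of [t^-w f] of negative exponent are nilpotent, so its
    part [u0] of nonnegative exponents is still a unit and [t^-w f / u0] is
    within the reach of [factor_near1]. *)
Lemma wfactor_ex f : f \is a GRing.unit -> exists w a, order f w /\ wfactor f w a.
Proof.
move=> fU; have [w ow] := order_ex fU; exists w.
pose f' := lmonom 1 (- w) * f.
have f'E : f = lmonom 1 w * f' by rewrite mulrA lmonomM mulr1 subrr mul1r.
have f'n n : f' n = f (n + w) by rewrite lcoef_monomM mul1r opprK.
have f'U : f' \is a GRing.unit by rewrite unitrM lmonom1_unit.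
have [N f'N] := lge_bound f'.
pose S := [seq f' (- i%:Z) | i <- iota 1 N].
have Sm c : c \in S -> m c.
  move=> /mapP [i]; rewrite mem_iota => /andP[i0 _] ->; rewrite f'n.
  by case: ow => + _; apply; lia.
have [M SM] : exists M, forall x, ipow S M x -> x = 0.
  by apply: ipow_nil => c /Sm /max_nil.
pose nu := neg_part f'; pose u0 := pos_part f'.
have nuI : lI S 1 nu.
  move=> n; rewrite neg_partE; case: ifP => n0; first exact: ipow_zero.
  have [lt|le] := ltP n (- N%:Z); first by rewrite f'N //; exact: ipow_zero.
  apply: ipow1; apply/mapP; exists (absz n); first by rewrite mem_iota; lia.
  by congr (f' _); lia.
have u0E : u0 = f' * (1 - nu / f') by rewrite mulrBr mulr1 mulrCA divrr // mulr1 [f' in RHS]partD addrK.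
have u0UU : u0 \is a GRing.unit.
  rewrite u0E unitrM f'U; apply: (@unit_1subnil _ _ M).
  by apply: (lI_nil SM); exact: lIMr.
have u0U : isU u0.
  split=> //; first exact: pos_part_pos.
  rewrite -[u0 0]/(f' 0) f'n add0r; case: ow => _ nm.
  by apply: contrapT => /negP /max_nonunit.
have [|u [k [uU kK kI e]]] := factor_near1 SM (ltn0Sn 0) (f := f' / u0).
  rewrite (_ : _ - 1 = nu / u0); first exact: lIMr.
  by rewrite [f']partD mulrDl divrr // addrAC subrr add0r.
have UU := isUM u0U uU; set v := u0 * u in UU.
have f'vk : f' = v * k by rewrite /v -mulrA -e mulrC divrK.
have v0U : v 0 \is a GRing.unit by case: UU.
have vU1 := isUM (isU_monom (etrans (unitrV (v 0)) v0U)) UU.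
set p := _ * v in vU1.
have p0 : p 0 = 1 by rewrite /p lcoef_monomM subr0 mulVr.
have [K kN] := lge_bound k.
(* [v_0] is split off so that the remaining series [p] has constant term 1 *)
pose a (n : int) : A :=
  match n with Posz 0 => v 0 | Posz i => pcoef p i | Negz i => ncoef k i.+1 end.
have aN i : (0 < i)%N -> a (- i%:Z) = ncoef k i by case: i.
exists a; split=> //; split=> //.
- move=> i i0; rewrite aN //; apply: (ipow_ideal m_ideal Sm).
  exact: (ncoefI SM kK kI kN).
- exists p, (K.+1 * M)%N; split.
  + have := prem_limit vU1 p0; rewrite /ppart => H d.
    have [B HB] := H d; exists B => n nB j jd; rewrite -(HB n nB j jd).
    by congr (lcoef _ j); rewrite big_nat [RHS]big_nat; apply: eq_bigr => -[].
  + by move=> i iN; rewrite aN ?(ncoef0 SM kK kI kN) //; lia.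
  + rewrite f'E f'vk {1}(nrem_prod SM kK kI kN (K.+1 * M)).
    rewrite (nrem_final SM kK kI kN) // mulr1 !mulrA; congr (_ * _).
      by rewrite lmonomM addr0 [a 0]/(v 0) divrr.
    rewrite big_nat [RHS]big_nat; apply: eq_bigr => i /andP[i0 _]; by rewrite aN.
Qed.
End LocalArtinian.

(** * The pairing and the Contou-Carrere symbol *)
Section UnitGroup.
Variable R : comUnitRingType.
Implicit Types x y : units R.
Lemma uval_inj x y : uval x = uval y -> x = y. Proof. exact: val_inj. Qed.
Lemma uvalM x y : uval (x * y)%g = uval x * uval y. Proof. by []. Qed.
Lemma uvalV x : uval (x^-1)%g = (uval x)^-1. Proof. by []. Qed.
End UnitGroup.

Section Pairing.
Variable A : comUnitRingType.
Hypotheses (A_local : local_ring A) (A_artinian : artinian_ring A).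
Notation L := (laurent A).
Notation m := (@the_maximal_ideal A).
Notation G := (units L).
Implicit Types f g h : G.

Lemma wfactorizationP f : wfactor (uval f) (winding f) (wcoef f).
Proof.
have [w [a [_ wf]]] := wfactor_ex A_local A_artinian (uvalP f).
exact: (@xgetI _ _ [set wa | wfactor (uval f) wa.1 wa.2]%classic (w, a)).
Qed.

Lemma wfactor_decomp f w a : wfactor (uval f) w a -> exists p N E,
  [/\ forall j : nat, (0 < j)%N -> a (- j%:Z) ^+ E = 0,
      forall j : nat, (N < j)%N -> a (- j%:Z) = 0 &
  [/\ a 0 \is a GRing.unit,
      tadic_limit (fun n => ppart (fun i => a i) 1 n.+1) p,
      p \is a GRing.unit &
      decomp (uval f) w (lmonom (a 0) 0 * p)
        (\prod_(1 <= j < N.+1) (1 - lmonom (a (- j%:Z)) (- j%:Z)))]].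
Proof.
move=> [a0 am [p [N [plim aN fE]]]].
have [E aE] := max_nil_unif A_local A_artinian am aN.
exists p, N, E; split=> //.
have pU : p \is a GRing.unit.
  by have := uvalP f; rewrite fE !unitrM => /andP[/andP[]].
have [pUU _] := limit_isU plim pU.
split=> //; split; [|exact: (isK_prod (y := fun j => a (- j%:Z)) aE)|].
  by apply: isUM => //; exact: isU_monom.
rewrite fE; congr (_ * _); rewrite mulrA; congr (_ * _).
by rewrite lmonomM mul1r addr0.
Qed.

Definition upart f : L := xget 1 [set u | exists k, decomp (uval f) (winding f) u k]%classic.
Definition kpart f : L := xget 1 [set k | decomp (uval f) (winding f) (upart f) k]%classic.

Lemma decomp_parts f : decomp (uval f) (winding f) (upart f) (kpart f).
Proof.
have [p [N [E [_ _ [_ _ _ d]]]]] := wfactor_decomp (wfactorizationP f).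
have [k' d'] : exists k, decomp (uval f) (winding f) (upart f) k.
  exact: (@xgetI _ 1 [set u | exists k, decomp (uval f) (winding f) u k]%classic _ (ex_intro _ _ d)).
exact: (@xgetI _ 1 [set k | decomp (uval f) (winding f) (upart f) k]%classic _ d').
Qed.

Lemma decompE f w u k : decomp (uval f) w u k ->
  [/\ winding f = w, upart f = u & kpart f = k].
Proof. by move=> d; have := decomp_uniq (decomp_parts f) d. Qed.

Lemma order_winding f : order (uval f) (winding f).
Proof.
have [w [a [ow wf]]] := wfactor_ex A_local A_artinian (uvalP f).
have [p [N [E [_ _ [_ _ _ /decompE [-> _ _]]]]]] := wfactor_decomp wf.
by [].
Qed.

Lemma upartU f : isU (upart f). Proof. by case: (decomp_parts f). Qed.
Lemma kpartK f : isK (kpart f). Proof. by case: (decomp_parts f). Qed.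

Lemma decompM f g : 
  [/\ winding (f * g)%g = winding f + winding g,
      upart (f * g)%g = upart f * upart g & kpart (f * g)%g = kpart f * kpart g].
Proof.
apply: decompE; have [uU kK fE] := decomp_parts f; have [vU hK gE] := decomp_parts g.
split; [exact: isUM|exact: isKM|rewrite /= {1}fE {1}gE].
have <- : lmonom 1 (winding f) * lmonom 1 (winding g)
    = lmonom 1 (winding f + winding g) :> L by rewrite lmonomM mulr1.
by ring.
Qed.

(** The numerator of the explicit formula; the denominator is the same
    expression with [f] and [g] exchanged. *)
Definition pairing_num f g : A := (upart f 0) ^ (winding g) * csym (upart f) (kpart g).

Lemma upart0_unit f : upart f 0 \is a GRing.unit.
Proof. by case: (upartU f). Qed.

Lemma pairing_num_unit f g : pairing_num f g \is a GRing.unit.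
Proof.
rewrite unitrM unitrXz ?upart0_unit //=.
by apply: csym_unit; [exact: upartU|exact: kpartK].
Qed.

Lemma exprzMunit (x y : A) (n : int) : x \is a GRing.unit -> y \is a GRing.unit ->
  (x * y) ^ n = x ^ n * y ^ n.
Proof.
move=> xU yU; case: n => n; first exact: exprMn.
by rewrite !NegzE -!invr_expz -!exprnP exprMn invrM ?unitrX // mulrC.
Qed.

Lemma pairing_numMl f g h : pairing_num (f * g)%g h = pairing_num f h * pairing_num g h.
Proof.
rewrite /pairing_num; have [_ -> _] := decompM f g.
have U1 := upartU f; have U2 := upartU g.
rewrite posM0 ?exprzMunit ?upart0_unit ?csymMl //;
  [|exact: kpartK|by case: U1|by case: U2].
by rewrite mulrACA.
Qed.

Lemma pairing_numMr f g h : pairing_num f (g * h)%g = pairing_num f g * pairing_num f h.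
Proof.
rewrite /pairing_num; have [-> _ ->] := decompM g h.
rewrite exprzDr ?upart0_unit // csymMr; [exact: mulrACA|exact: upartU|exact: kpartK..].
Qed.

(** The coefficients of the infinite products behave badly under
    multiplication, but [upart], [kpart] and [csym] are multiplicative. *)
Lemma pairingE f g : uval (pairing A_local f g) = pairing_num f g / pairing_num g f.
Proof.
have [p [N [E [yE yN [a0U plim pU d]]]]] := wfactor_decomp (wfactorizationP f).
have [q [N' [E' [zE zN [b0U qlim qU d']]]]] := wfactor_decomp (wfactorizationP g).
pose y (j : nat) := wcoef f (- j%:Z); pose z (j : nat) := wcoef g (- j%:Z).
have [pUU p0] := limit_isU plim pU; have [qUU q0] := limit_isU qlim qU.
have aUU := isU_monom a0U; have bUU := isU_monom b0U.
have yK := isK_prod (y := y) yE N.+1; have zK := isK_prod (y := z) zE N'.+1.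
rewrite /= /pairing_val /pairing_num.
have [_ -> ->] := decompE d; have [_ -> ->] := decompE d'.
rewrite !csymMl // ?csym_const //.
rewrite !posM0 ?p0 ?q0; try (exact: lge_monom); [|by case: qUU|by case: pUU].
have ef := csym_product (y := z) zE zN plim pU.
have eg := csym_product (y := y) yE yN qlim qU.
rewrite !mulr1 ef eg [1 * cc_prod _ z]mul1r [1 * cc_prod _ y]mul1r.
by rewrite (cc_prodC (y := y) _ yE yN) (lcoef_monom _ 0 0) (lcoef_monom _ 0 0) eqxx.
Qed.

Notation cc := (contou_carrere A_local).
Notation pr := (pairing A_local).

Lemma pairingMl f g h : pr (f * g)%g h = (pr f h * pr g h)%g.
Proof.
apply: uval_inj; rewrite [RHS]uvalM (pairingE (f * g)%g h).
rewrite (pairingE f) (pairingE g) pairing_numMl pairing_numMr.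
rewrite invrM; [|exact: pairing_num_unit..].
by rewrite [(pairing_num h g)^-1 * _]mulrC mulrACA.
Qed.

Lemma pairingV f g : pr g f = (pr f g)^-1%g.
Proof.
apply: uval_inj; rewrite [RHS]uvalV (pairingE g f) (pairingE f g).
rewrite [RHS]invrM; [by rewrite invrK|exact: pairing_num_unit|].
by rewrite unitrV; exact: pairing_num_unit.
Qed.

Lemma pairingMr f g h : pr f (g * h)%g = (pr f g * pr f h)%g.
Proof. by rewrite pairingV pairingMl invgM -!pairingV units_mulC. Qed.

Lemma sgn_unit (n : int) : ((-1) ^ n : A) \is a GRing.unit.
Proof. by rewrite unitrXz // unitrN1. Qed.
Definition sgn n : units A := Units (sgn_unit n).

Lemma sgnD a b : sgn (a + b) = (sgn a * sgn b)%g.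
Proof. by apply: val_inj; rewrite /= exprzDr // unitrN1. Qed.

Lemma sgn0 : sgn 0 = 1%g.
Proof. exact: val_inj. Qed.

Lemma sgn2 a : sgn (2 * a) = 1%g.
Proof. by apply: val_inj; rewrite /= -exprz_exp -exprnP sqrrN !expr1n exp1rz. Qed.

Lemma sgnN a : sgn (- a) = sgn a.
Proof. by rewrite -[RHS]mul1g -(sgn2 (- a)) -sgnD; congr sgn; ring. Qed.

Lemma ccE f g : cc f g = (sgn (winding f * winding g) * pr f g)%g.
Proof. exact: val_inj. Qed.

Lemma cc_bimult : bimultiplicative cc.
Proof.
split=> f g h; rewrite !ccE.
  have [-> _ _] := decompM f g; rewrite mulrDl sgnD pairingMl.
  by rewrite -!mulgA; congr (_ * _)%g; rewrite !mulgA; congr (_ * _)%g; rewrite units_mulC.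
have [-> _ _] := decompM g h; rewrite mulrDr sgnD pairingMr.
by rewrite -!mulgA; congr (_ * _)%g; rewrite !mulgA; congr (_ * _)%g; rewrite units_mulC.
Qed.

Lemma ccV f g : cc g f = (cc f g)^-1%g.
Proof.
rewrite !ccE pairingV invgM units_mulC mulrC -{1}sgnN; congr (_ * _)%g.
by apply: uval_inj; rewrite uvalV /= invr_expz.
Qed.

End Pairing.

Section Bimult.
Variables (G B : groupType) (psi : G -> G -> B).
Hypothesis psiM : bimultiplicative psi.
Local Open Scope group_scope.

Lemma bim1l x : psi 1 x = 1.
Proof. by apply: (mulgI (psi 1 x)); rewrite -(proj1 psiM) !mulg1. Qed.
Lemma bim1r x : psi x 1 = 1.
Proof. by apply: (mulgI (psi x 1)); rewrite -(proj2 psiM) !mulg1. Qed.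
Lemma bimVl x y : psi x^-1 y = (psi x y)^-1.
Proof. by apply: (mulgI (psi x y)); rewrite -(proj1 psiM) !mulgV bim1l. Qed.
Lemma bimVr x y : psi x y^-1 = (psi x y)^-1.
Proof. by apply: (mulgI (psi x y)); rewrite -(proj2 psiM) !mulgV bim1r. Qed.
Lemma bim_cocycle : (forall b c : B, b * c = c * b) -> cocycle2 psi.
Proof.
move=> C x y z; rewrite (proj1 psiM) (proj2 psiM).
by rewrite mulgA C.
Qed.
End Bimult.

(** * The Steinberg relation, the cohomology class and uniqueness *)
Section Steinberg.
Variable A : comUnitRingType.
Hypotheses (A_local : local_ring A) (A_artinian : artinian_ring A).
Notation L := (laurent A).
Notation m := (@the_maximal_ideal A).
Notation G := (units L).
Notation cc := (contou_carrere A_local).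
Notation pr := (pairing A_local).
Implicit Types f g h : G.

Let bim := cc_bimult A_local A_artinian.
Let windM f g : winding (f * g)%g = winding f + winding g.
Proof. by case: (decompM A_local A_artinian f g). Qed.
Let wind_unique f w u k : decomp (uval f) w u k -> winding f = w.
Proof. by move/(decompE A_local A_artinian) => []. Qed.

Lemma winding1 : winding (1%g : G) = 0.
Proof. by have := windM 1%g 1%g; rewrite mulg1 -{1}[winding _]addr0 => /addrI. Qed.

Lemma windingV f : winding (f^-1)%g = - winding f.
Proof. by apply/eqP; rewrite -addr_eq0 -windM mulVg winding1. Qed.

Definition const_unit (c : A) (cU : c \is a GRing.unit) : G := Units (lmonom_unit 0 cU).
Definition minus1 : G := const_unit (unitrN1 A).
Definition tpar : G := Units (lmonom1_unit A 1).

Lemma decomp_const (c : A) (cU : c \is a GRing.unit) :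
  decomp (uval (const_unit cU)) 0 (lmonom c 0) 1.
Proof. by split; [exact: isU_monom|exact: isK1|rewrite mulr1 mul1r]. Qed.

Lemma winding_minus1 : winding minus1 = 0.
Proof. exact: wind_unique (decomp_const _). Qed.

Lemma winding_tpar : winding tpar = 1.
Proof.
apply: (@wind_unique _ _ 1 1); split; [exact: isU1|exact: isK1|by rewrite !mulr1].
Qed.

Lemma minus1E : uval minus1 = -1.
Proof. by rewrite /= lmonomN. Qed.

Lemma cc_minus1 f : cc f minus1 = sgn A (winding f).
Proof.
rewrite ccE winding_minus1 mulr0 sgn0 mul1g; apply: uval_inj.
rewrite (pairingE A_local A_artinian f minus1) /pairing_num.
have [-> -> ->] := decompE A_local A_artinian (decomp_const (unitrN1 A)).
rewrite csym1r ?csym_const ?unitrN1 //; [|exact: kpartK|exact: upartU].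
by rewrite expr0z !mulr1 mul1r lcoef_monom eqxx invr_expz -exprz_inv invrN1.
Qed.

Lemma cc_self f : cc f f = sgn A (winding f).
Proof.
rewrite ccE; have -> : pr f f = 1%g.
  apply: uval_inj; rewrite (pairingE A_local A_artinian f f) divrr //.
  exact: pairing_num_unit.
rewrite mulg1; have [c|c] : (winding f = 2 * (winding f %/ 2)%Z \/ winding f = 2 * (winding f %/ 2)%Z + 1).
  by lia.
  by rewrite {1 3}c -mulrA !sgn2.
set q := (_ %/ 2)%Z in c.
rewrite {1 3}c mulrDl mul1r -mulrA sgnD sgn2 mul1g c //.
Qed.

Lemma cc_neg f : cc f (minus1 * f)%g = 1%g.
Proof.
rewrite (proj2 bim) cc_self cc_minus1 -sgnD -(sgn2 A (winding f)).
by congr sgn; ring.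
Qed.

Lemma cc_steinberg_ge0 f g : uval g = 1 - uval f -> 0 <= winding f -> winding g = 0 ->
  cc f g = 1%g.
Proof.
move=> gf f0 g0; rewrite ccE g0 mulr0 sgn0 mul1g; apply: uval_inj.
rewrite (pairingE A_local A_artinian f g) /pairing_num g0 expr0z mul1r.
have [uU kK fE] := decomp_parts A_local A_artinian f.
have [vU hK gE] := decomp_parts A_local A_artinian g.
rewrite g0 lmonom1 mul1r in gE.
have [w wE] : exists w : nat, winding f = w%:Z by exists (absz (winding f)); lia.
rewrite wE in fE *.
have st := csym_steinberg (w := w) uU vU kK hK.
rewrite st ?divrr // -?fE -?gE ?gf 1?addrC ?subrK //.
rewrite unitrM unitrX ?csym_unit //; by case: vU.
Qed.

(** Comparing valuations modulo the maximal ideal, [w(f) > 0] forces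
    [w(1 - f) = 0] and [w(f) = 0] forces [w(1 - f) >= 0]. When [w(f) < 0], the
    relation [1 - f = - f (1 - f^-1)] reduces to [f^-1]. *)
Lemma cc_steinberg : steinberg cc.
Proof.
split=> // f g gf.
have [fm fw] := order_winding A_local A_artinian f.
have [gm gw] := order_winding A_local A_artinian g.
have [mi mT _] := the_maximal_idealP A_local.
have m1 := ideal_neqT mi mT; case: mi => m0 mD mM.
have gn n : uval g n = (n == 0)%:R - uval f n by rewrite gf lcoefD lcoefN lcoef1.
have gneg n : m (uval f n) -> n != 0 -> m (uval g n).
  by move=> mf /negPf n0; rewrite gn n0 sub0r -mulN1r; exact: mM.
have pos_case f' g' : uval g' = 1 - uval f' -> 0 < winding f' -> cc f' g' = 1%g.
  move=> e f'0; apply: cc_steinberg_ge0 => //; first exact: ltW.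
  have [fm' _] := order_winding A_local A_artinian f'.
  have o : order (uval g') 0.
    split=> [n n0|].
      rewrite e lcoefD lcoefN lcoef1; case: eqP => [|_]; first by lia.
      by rewrite sub0r -mulN1r; apply: mM; apply: fm'; lia.
    rewrite e lcoefD lcoefN lcoef1 eqxx => /mD /(_ (fm' 0 f'0)).
    by rewrite subrK.
  exact: order_uniq (order_winding A_local A_artinian g') o.
have fg : uval f = 1 - uval g by rewrite gf opprB addrC subrK.
case: (ltgtP (winding f) 0) => w0.
- pose g' : G := ((minus1 * f)^-1 * g)%g.
  have g'E : uval g' = 1 - uval (f^-1)%g.
    rewrite uvalM uvalV uvalM minus1E uvalV gf mulN1r invrN mulNr mulrBr mulr1.
    by rewrite mulVr ?uvalP // opprB.
  have -> : g = (minus1 * f * g')%g by rewrite /g' mulVKg.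
  rewrite (proj2 bim) cc_neg mul1g.
  have := pos_case _ _ g'E; rewrite windingV oppr_gt0 => /(_ w0).
  by rewrite (bimVl bim) => /(congr1 (fun x => x^-1)%g); rewrite invgK invg1.
- exact: pos_case.
- rewrite ccV // cc_steinberg_ge0 ?invg1 //.
  rewrite leNgt; apply/negP => lt; apply: gw; apply: gneg; last by lia.
  by apply: fm; rewrite w0.
Qed.

(** The quadratic function with polar form [a b]; see [triD]. *)
Definition tri (n : int) : int := ((n * (n - 1)) %/ 2)%Z.

Lemma triD a b : tri (a + b) = tri a + tri b + a * b.
Proof.
have tri2 n : 2 * tri n = n * (n - 1).
  have [k e] : exists k, n * (n - 1) = k * 2.
    have [e|e] : n = 2 * (n %/ 2)%Z \/ n = 2 * (n %/ 2)%Z + 1 by lia.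
      by exists ((n %/ 2)%Z * (n - 1)); rewrite {1}e; ring.
    by exists (n * (n %/ 2)%Z); rewrite {2}e; ring.
  by rewrite /tri e mulzK // mulrC.
have := tri2 (a + b); have := tri2 a; have := tri2 b; nia.
Qed.

Lemma cc_class : cohomology_class pr cc.
Proof.
split; first by apply: bim_cocycle => //; exact: units_mulC.
exists (fun f => sgn A (tri (winding f))) => f g.
rewrite ccE -mulgA mulgV mulg1 windM triD !sgnD.
move: (sgn A (tri (winding f))) (sgn A (tri (winding g))) => x y.
by rewrite (units_mulC (x * y)%g) (units_mulC x) !mulgA !mulgK.
Qed.

(** The group is generated by [t] and the series of winding number 0. *)
Lemma winding_ind (P : G -> Prop) : (forall f, winding f = 0 -> P f) ->
  P tpar -> (forall f g, P f -> P g -> P (f * g)%g) ->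
  (forall f, P f -> P (f^-1)%g) -> forall f, P f.
Proof.
move=> P0 Pt PM PV f; have [n] := ubnP (absz (winding f)).
elim: n f => // n IHn f lt; case: (ltgtP (winding f) 0) => w0; last exact: P0.
- rewrite -(mulgK tpar f); apply: (PM _ _ _ (PV _ Pt)); apply: IHn.
  by rewrite windM winding_tpar; lia.
- rewrite -(mulgVK tpar f); apply: (PM _ _ _ Pt); apply: IHn.
  by rewrite windM windingV winding_tpar; lia.
Qed.

(** [-t = (1 - t) / (1 - t^-1)], and both [mu(t, 1 - t)] and
    [mu(t^-1, 1 - t^-1)] are trivial. *)
Lemma steinberg_neg_tpar (mu : G -> G -> units A) : steinberg mu ->
  mu tpar (minus1 * tpar)%g = 1%g.
Proof.
move=> [muM st]; pose f : G := Units (geom_unit 1 (ltn0Sn 0)).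
pose g : G := ((minus1 * tpar)^-1 * f)%g.
have -> : (minus1 * tpar)%g = (f * g^-1)%g.
  by rewrite /g invgM invgK mulVKg.
rewrite (proj2 muM) (bimVr muM) st // mul1g.
suff : mu (tpar^-1)%g g = 1%g by rewrite (bimVl muM).
apply: st; rewrite /g uvalM uvalV uvalM minus1E uvalV mulN1r invrN mulNr.
by rewrite mulrBr mulr1 mulVr ?uvalP // opprB.
Qed.

Lemma steinberg_uniq (mu nu : G -> G -> units A) :
  steinberg mu -> steinberg nu ->
  cohomology_class pr mu -> cohomology_class pr nu ->
  (forall f g, winding f = 0 -> mu f g = pr f g) ->
  (forall f g, winding f = 0 -> nu f g = pr f g) -> mu = nu.
Proof.
move=> smu snu [_ [phi mphi]] [_ [psi npsi]] mu0 nu0.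
have C := @units_mulC A.
pose s f g := (mu f g * (nu f g)^-1)%g.
have sM : bimultiplicative s.
  have [[ml mr] _] := smu; have [[nl nr] _] := snu.
  have swap (a b c d : units A) : (a * b * (c * d)^-1 = a * c^-1 * (b * d^-1))%g.
    by rewrite (C c) invgM -!mulgA; congr (_ * _)%g; rewrite mulgA (C b c^-1%g) -mulgA.
  by split=> f g h; rewrite /s ?ml ?nl ?mr ?nr swap.
have sE f g : s f g = ((mu f g * (pr f g)^-1) * (nu f g * (pr f g)^-1)^-1)%g.
  by rewrite invgM invgK mulgA mulgVK.
have symm f g : s f g = s g f.
  have sw (rho : G -> units A) a b c d : (rho (a * b) * (rho c)^-1 * (rho d)^-1
      = rho (a * b) * (rho d)^-1 * (rho c)^-1)%g.
    by rewrite -!mulgA; congr (_ * _)%g; exact: C.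
  by rewrite !sE !mphi !npsi (units_mulC f) (sw phi) (sw psi).
have s0 f g : winding f = 0 -> s f g = 1%g.
  by move=> f0; rewrite /s mu0 // nu0 // mulgV.
have stt : s tpar tpar = 1%g.
  have e : tpar = (minus1 * (minus1 * tpar))%g.
    by apply: uval_inj; rewrite !uvalM minus1E !mulN1r opprK.
  rewrite [X in s _ X]e (proj2 sM) symm (s0 _ _ winding_minus1) mul1g.
  by rewrite /s !steinberg_neg_tpar // mulgV.
have st f : s f tpar = 1%g.
  elim/winding_ind: f => [f|//|f g sf sg|f sf]; first exact: s0.
    by rewrite (proj1 sM) sf sg mulg1.
  by rewrite (bimVl sM) sf invg1.
have s1 f g : s f g = 1%g.
  elim/winding_ind: g => [g g0|//|g h sg sh|g sg]; first by rewrite symm s0.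
    by rewrite (proj2 sM) sg sh mulg1.
  by rewrite (bimVr sM) sg invg1.
apply: funext => f; apply: funext => g.
by rewrite -[RHS]mul1g -(s1 f g) /s mulgVK.
Qed.

End Steinberg.

Theorem proposition4p4 (A : comUnitRingType)
    (A_local : local_ring A) (A_artinian : artinian_ring A) :
  exists nu : units (laurent A) -> units (laurent A) -> units A,
    unique (fun mu : units (laurent A) -> units (laurent A) -> units A =>
      [/\ steinberg mu,
          cohomology_class (pairing A_local) mu &
          forall f g : units (laurent A), winding f = 0 ->
            mu f g = pairing A_local f g]) nu
    /\ nu = contou_carrere A_local.
Proof.
exists (contou_carrere A_local); split=> //.
have st := cc_steinberg A_local A_artinian.
have cl := cc_class A_local A_artinian.
have w0 (f g : units (laurent A)) : winding f = 0 ->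
    contou_carrere A_local f g = pairing A_local f g.
  by move=> f0; rewrite ccE f0 mul0r sgn0 mul1g.
by split=> // mu [mu_st mu_cl mu_w0]; exact: (steinberg_uniq A_artinian st mu_st cl mu_cl).
Qed.
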